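(* Let $H\leq PL_o(I)$. If $H$ admits a transition chain of length two, then $B$ embeds in $H$ (that is, $H$ has a subgroup isomorphic to $B$).
   Context: $PL_o(I)$ denotes the group, under composition, of orientation-preserving piecewise-linear homeomorphisms of the unit interval $I=[0,1]$ which admit finitely many breaks in slope. Group actions are right actions ($xg$ is the image of $x$ under $g$) and composition is from left to right. Orbitals. For $G\leq PL_o(I)$, the support of $G$ is $\mathrm{Supp}(G)=\{x\in I\mid xg\neq x\text{ for some }g\in G\}$, an open subset of $(0,1)$. A connected component of $\mathrm{Supp}(G)$ is an orbital of $G$. For $g\in PL_o(I)$, an orbital of $g$ is an orbital of $\langle g\rangle$. A signed orbital of $G$ is a pair $(A,g)$ with $g\in G$ and $A$ an orbital of $g$. Transition chains of length two. A transition chain of length two for $G$ is a set $\{(A,g),(B',h)\}$ of signed orbitals of $G$ with $A=(a_l,a_r)$, $B'=(b_l,b_r)$ and $a_l<b_l<a_r<b_r$. $G$ admits a transition chain of length two if such a set exists. The group $B$. Define $\alpha,\beta_0\in PL_o(I)$ by $$x\alpha=\begin{cases}\frac14x&0\le x<\frac14\\ x-\frac3{16}&\frac14\le x<\frac7{16}\\ 4x-\frac32&\frac7{16}\le x<\frac9{16}\\ x+\frac3{16}&\frac9{16}\le x<\frac34\\ \frac14x+\frac34&\frac34\le x\le1\end{cases}\qquad x\beta_0=\begin{cases}x&0\le x<\frac7{16}\\ 2x-\frac7{16}&\frac7{16}\le x<\frac{15}{32}\\ x+\frac1{32}&\frac{15}{32}\le x<\frac12\\ \frac12x+\frac9{32}&\frac12\le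 x<\frac9{16}\\ x&\frac9{16}\le x\le1.\end{cases}$$ Then $B=\langle\alpha,\beta_0\rangle\leq PL_o(I)$. *)

(* Defs.v *)
From HB Require Import structures.
From mathcomp Require Import all_boot all_order all_algebra.
From mathcomp Require Import all_classical all_reals all_analysis.
From mathcomp Require Import lra.

Set Implicit Arguments.
Unset Strict Implicit.
Unset Printing Implicit Defensive.

Import Order.TTheory GRing.Theory Num.Theory.
Import numFieldNormedType.Exports.

Local Open Scope classical_set_scope.
Local Open Scope ring_scope.

Definition homeomorphism_on {T U : topologicalType} (A : set T) (B : set U)
    (f : T -> U) (g : U -> T) :=
  [/\ set_fun A B f /\ set_fun B A g,
      (forall x, A x -> g (f x) = x) /\ (forall y, B y -> f (g y) = y),
      {within A, continuous f} & {within B, continuous g}].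

Section PLo.
Variable R : realType.
Implicit Types (f g : R -> R) (a b x y : R).

(* The breaks in slope all lie in the finite list [s]. *)
Definition finitely_many_breaks f := exists s : seq R,
  forall a b, 0 <= a -> a < b -> b <= 1 ->
    (forall c, c \in s -> ~ (a < c < b)) ->
    exists m p, forall x, a <= x <= b -> f x = m * x + p.

(* A self-map of [0,1] is encoded by its extension by the identity to R, so
   that equality of maps of [0,1] is equality of functions on R. *)
Record is_plo f : Prop := IsPLo {
  plo_out : forall x, ~ (0 <= x <= 1) -> f x = x;
  plo_homeo : exists g, homeomorphism_on (`[0, 1] : set R) (`[0, 1] : set R) f g;
  plo_incr : forall x y, 0 <= x -> x < y -> y <= 1 -> f x < f y;
  plo_breaks : finitely_many_breaks f }.

Record PLo := MkPLo { plo_fun :> R -> R; ploP : is_plo plo_fun }.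

Lemma plo_eq (u v : PLo) : plo_fun u =1 plo_fun v -> u = v.
Proof.
case: u v => [f Pf] [g Pg] /= /funext E; move: Pf Pg; rewrite E => Pf Pg.
by rewrite (Prop_irrelevance Pf Pg).
Qed.

Lemma homeomorphism_onI f g :
  (forall x, 0 <= x <= 1 -> 0 <= f x <= 1) ->
  (forall x, 0 <= x <= 1 -> 0 <= g x <= 1) ->
  (forall x, 0 <= x <= 1 -> g (f x) = x) ->
  (forall x, 0 <= x <= 1 -> f (g x) = x) ->
  (forall x y, 0 <= x -> x < y -> y <= 1 -> f x < f y) ->
  homeomorphism_on (`[0, 1] : set R) (`[0, 1] : set R) f g.
Proof.
have cont h k : (forall x, 0 <= x <= 1 -> 0 <= h x <= 1) ->
    (forall x, 0 <= x <= 1 -> 0 <= k x <= 1) ->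
    (forall x, 0 <= x <= 1 -> h (k x) = x) ->
    (forall x y, 0 <= x -> x < y -> y <= 1 -> h x < h y) ->
    {within `[0 : R, 1], continuous h}.
  move=> hI kI hk hlt; have le01 : (0 : R) <= 1 by [].
  have monoh : {in `[0, 1] &, {mono h : x y / x <= y}}.
    apply: le_mono_in => x y; rewrite !in_itv /= => /andP[x0 _] /andP[_ y1] xy.
    exact: hlt.
  have in0 : (0 : R) \in `[0, 1] by rewrite in_itv /= lexx ler01.
  have in1 : (1 : R) \in `[0, 1] by rewrite in_itv /= lexx ler01.
  apply: segment_inc_surj_continuous => // y /=; rewrite in_itv /= => /andP[y0 y1].
  have /andP[h0 _] : 0 <= h 0 <= 1 by apply: hI; rewrite lexx ler01.
  have /andP[_ h1] : 0 <= h 1 <= 1 by apply: hI; rewrite lexx ler01.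
  have yI : 0 <= y <= 1 by rewrite (le_trans h0 y0) (le_trans y1 h1).
  by exists (k y); [rewrite /= in_itv /= kI | rewrite hk].
move=> fI gI gf fg flt.
have glt x y : 0 <= x -> x < y -> y <= 1 -> g x < g y.
  move=> x0 xy y1.
  have xI : 0 <= x <= 1 by rewrite x0 (le_trans (ltW xy)).
  have yI : 0 <= y <= 1 by rewrite y1 (le_trans x0 (ltW xy)).
  rewrite ltNge; apply/negP; rewrite le_eqVlt => /orP[/eqP E|lt].
    by move: xy; rewrite -(fg _ xI) -(fg _ yI) E ltxx.
  have /andP[g0 _] := gI _ yI; have /andP[_ g1] := gI _ xI.
  by have := flt _ _ g0 lt g1; rewrite !fg // ltNge (ltW xy).
split.
- by split=> x /=; rewrite !in_itv /=; [apply: fI | apply: gI].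
- by split=> x /=; rewrite in_itv /=; [apply: gf | apply: fg].
- exact: cont fI gI fg flt.
- exact: cont gI fI gf glt.
Qed.

Lemma homeomorphism_onE f g : homeomorphism_on (`[0, 1] : set R) (`[0, 1] : set R) f g ->
  [/\ forall x, 0 <= x <= 1 -> 0 <= f x <= 1,
      forall x, 0 <= x <= 1 -> 0 <= g x <= 1,
      forall x, 0 <= x <= 1 -> g (f x) = x &
      forall x, 0 <= x <= 1 -> f (g x) = x].
Proof.
move=> [[fI gI] [gf fg] _ _]; split=> x xI.
- by have := fI x; rewrite /= !in_itv /=; apply.
- by have := gI x; rewrite /= !in_itv /=; apply.
- by apply: gf; rewrite /= in_itv.
- by apply: fg; rewrite /= in_itv.
Qed.

Lemma is_plo_id : is_plo id.
Proof.
split=> //; first by exists id; apply: homeomorphism_onI.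
by exists [::] => a b _ _ _ _; exists 1, 0 => x _; rewrite mul1r addr0.
Qed.

Lemma is_plo_comp f g : is_plo f -> is_plo g -> is_plo (g \o f).
Proof.
move=> [fo [f' /homeomorphism_onE[fI f'I f'f ff']] flt [sf fb]].
move=> [go [g' /homeomorphism_onE[gI g'I g'g gg']] glt [sg gb]].
have lt x y : 0 <= x -> x < y -> y <= 1 -> (g \o f) x < (g \o f) y.
  move=> x0 xy y1 /=; apply: glt; last 1 first.
  - by have /andP[] : 0 <= f y <= 1 by apply: fI; rewrite y1 (le_trans x0 (ltW xy)).
  - by have /andP[] : 0 <= f x <= 1 by apply: fI; rewrite x0 (le_trans (ltW xy)).
  - exact: flt.
split=> //.
- by move=> x xI /=; rewrite fo // go.
- exists (f' \o g'); apply: homeomorphism_onI => //= x xI.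
  + exact/gI/fI.
  + exact/f'I/g'I.
  + by rewrite g'g ?f'f //; apply: fI.
  + by rewrite ff' ?gg' //; apply: g'I.
- exists (sf ++ [seq f' y | y <- sg]) => a b a0 ab b1 nobrk.
  have aI : 0 <= a <= 1 by rewrite a0 (le_trans (ltW ab)).
  have bI : 0 <= b <= 1 by rewrite b1 (le_trans a0 (ltW ab)).
  have [|m [p fE]] := fb a b a0 ab b1.
    by move=> c cs; apply: nobrk; rewrite mem_cat cs.
  have /andP[fa0 fa1] := fI _ aI; have /andP[fb0 fb1] := fI _ bI.
  have fle x y : 0 <= x -> x <= y -> y <= 1 -> f x <= f y.
    move=> x0; rewrite le_eqVlt => /orP[/eqP-> //|xy] y1.
    exact/ltW/flt.
  have [|m' [p' gE]] := gb (f a) (f b) fa0 (flt _ _ a0 ab b1) fb1.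
    move=> c cs /andP[ac cb]; apply: (nobrk (f' c)).
      by rewrite mem_cat map_f ?orbT.
    have cI : 0 <= c <= 1 by rewrite (le_trans fa0 (ltW ac)) (le_trans (ltW cb)).
    have /andP[c0 c1] := f'I _ cI.
    apply/andP; split; rewrite ltNge; apply/negP => le.
    + by have := fle _ _ c0 le (le_trans (ltW ab) b1); rewrite ff' // leNgt ac.
    + by have := fle _ _ (le_trans a0 (ltW ab)) le c1; rewrite ff' // leNgt cb.
  exists (m' * m), (m' * p + p') => x /[dup] xab /andP[ax xb] /=.
  rewrite gE; first by rewrite fE // mulrDr mulrA addrA.
  by rewrite !fle // ?(le_trans a0 ax) // (le_trans xb b1).
Qed.

Lemma is_plo_inv f : is_plo f ->
  exists2 g, is_plo g & cancel f g /\ cancel g f.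
Proof.
move=> [fo [f' /homeomorphism_onE[fI f'I f'f ff']] flt [s fb]].
pose g x := if 0 <= x <= 1 then f' x else x.
have gE x : 0 <= x <= 1 -> g x = f' x by rewrite /g => ->.
have fg : cancel f g.
  move=> x; have [xI|/negP xI] := boolP (0 <= x <= 1).
    by rewrite gE ?f'f //; apply: fI.
  by rewrite fo // /g; case: ifP => // /xI.
have gf : cancel g f.
  move=> x; have [xI|/[dup] xI /negP nxI] := boolP (0 <= x <= 1).
    by rewrite gE ?ff'.
  by rewrite /g (negbTE xI) fo.
have gI x : 0 <= x <= 1 -> 0 <= g x <= 1 by move=> xI; rewrite gE ?f'I.
have fle x y : 0 <= x -> x <= y -> y <= 1 -> f x <= f y.
  move=> x0; rewrite le_eqVlt => /orP[/eqP-> //|xy] y1.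
  exact/ltW/flt.
have glt x y : 0 <= x -> x < y -> y <= 1 -> g x < g y.
  move=> x0 xy y1; rewrite ltNge; apply/negP => le.
  have /gI/andP[_ gx1] : 0 <= x <= 1 by rewrite x0 (le_trans (ltW xy)).
  have /gI/andP[gy0 _] : 0 <= y <= 1 by rewrite y1 (le_trans x0 (ltW xy)).
  by have := fle _ _ gy0 le gx1; rewrite !gf leNgt xy.
exists g => //; split=> //.
- by move=> x xI; rewrite /g; case: ifP => // /xI.
- by exists f; apply: homeomorphism_onI.
- exists [seq f y | y <- s] => a b a0 ab b1 nobrk.
  have aI : 0 <= a <= 1 by rewrite a0 (le_trans (ltW ab)).
  have bI : 0 <= b <= 1 by rewrite b1 (le_trans a0 (ltW ab)).
  have /andP[ga0 ga1] := gI _ aI; have /andP[gb0 gb1] := gI _ bI.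
  have gab := glt _ _ a0 ab b1.
  have [|m [p fE]] := fb (g a) (g b) ga0 gab gb1.
    move=> c cs /andP[ac cb]; apply: (nobrk (f c)); first exact: map_f.
    rewrite -(gf a) -(gf b); apply/andP; split; apply: flt => //.
      exact: le_trans (ltW cb) gb1.
    exact: le_trans ga0 (ltW ac).
  have m0 : m != 0.
    apply/eqP => m0; move: ab; rewrite -(gf a) -(gf b).
    by rewrite !fE ?lexx ?(ltW gab) // m0 !mul0r ltxx.
  have gle x y : 0 <= x -> x <= y -> y <= 1 -> g x <= g y.
    move=> x0; rewrite le_eqVlt => /orP[/eqP-> //|xy] y1.
    exact/ltW/glt.
  exists m^-1, (- (m^-1 * p)) => x /andP[ax xb].
  have xE : x = m * g x + p.
    by rewrite -fE ?gf // !gle ?(le_trans a0 ax) ?(le_trans xb b1).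
  by rewrite {2}xE mulrDr addrK mulKf.
Qed.

HB.instance Definition _ := gen_eqMixin PLo.
HB.instance Definition _ := gen_choiceMixin PLo.

Definition plo_one : PLo := MkPLo is_plo_id.

(* Right actions: [u * v] is [u] followed by [v]. *)
Definition plo_mul (u v : PLo) : PLo := MkPLo (is_plo_comp (ploP u) (ploP v)).

Definition plo_inv (u : PLo) : PLo :=
  MkPLo (s2valP (cid2 (is_plo_inv (ploP u)))).

Lemma plo_invP (u : PLo) : cancel u (plo_inv u) /\ cancel (plo_inv u) u.
Proof. exact: (s2valP' (cid2 (is_plo_inv (ploP u)))). Qed.

Fact plo_mulA : associative plo_mul. Proof. by move=> u v w; apply: plo_eq. Qed.
Fact plo_mul1g : left_id plo_one plo_mul. Proof. by move=> u; apply: plo_eq. Qed.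
Fact plo_mulg1 : right_id plo_one plo_mul. Proof. by move=> u; apply: plo_eq. Qed.
Fact plo_mulVg : left_inverse plo_one plo_inv plo_mul.
Proof. by move=> u; apply: plo_eq => x; apply: (plo_invP u).2. Qed.
Fact plo_mulgV : right_inverse plo_one plo_inv plo_mul.
Proof. by move=> u; apply: plo_eq => x; apply: (plo_invP u).1. Qed.

HB.instance Definition _ :=
  isGroup.Build PLo plo_mulA plo_mul1g plo_mulg1 plo_mulVg plo_mulgV.

End PLo.

Section Groups.
Variable gT : groupType.

Definition is_subgroup (H : set gT) := group_closed [in H].

Definition generated (S : set gT) : set gT := smallest is_subgroup S.

End Groups.

Definition isomorphic {gT hT : groupType} (G : set gT) (H : set hT) :=
  exists2 phi : gT -> hT,
    set_bij G H phi & {in G &, {morph phi : x y / (x * y)%g}}.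

Definition embeds_in {gT hT : groupType} (G : set gT) (H : set hT) :=
  exists K : set hT, [/\ is_subgroup K, K `<=` H & isomorphic G K].

Section Orbitals.
Variable R : realType.
Implicit Types (G : set (PLo R)) (A : set R) (g : PLo R).

Definition Supp G : set R :=
  [set x | 0 <= x <= 1 /\ exists2 g, G g & g x != x].

Definition orbital G A :=
  exists2 x, Supp G x & A = connected_component (Supp G) x.

Definition orbital_of g A := orbital (generated [set g]) A.

Definition signed_orbital G (Ag : set R * PLo R) :=
  G Ag.2 /\ orbital_of Ag.2 Ag.1.

Definition transition_chain2 G (C : set (set R * PLo R)) :=
  exists (al ar bl br : R) g h,
    [/\ C = [set (`]al, ar[%classic, g); (`]bl, br[%classic, h)],
        C `<=` signed_orbital G &
        [/\ al < bl, bl < ar & ar < br]].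

Definition admits_transition_chain2 G := exists C, transition_chain2 G C.

End Orbitals.

(* Decide each test, or split on it when it is undetermined; a new lower bound
   then supersedes the earlier one. *)
Local Ltac split_ifs :=
  let lower a := try match goal with H : is_true (_ <= a) |- _ => clear H end in
  repeat match goal with
  | |- context [if ?a < ?b then _ else _] =>
      first [ rewrite (@le_gtF _ _ b a); last lra
            | rewrite (_ : (a < b) = true); last lra
            | case: (ltP a b) => [?|]; [| lower a; move=> ?] ]
  | |- context [if ?a <= ?b then _ else _] =>
      first [ rewrite (_ : (a <= b) = true); last lra
            | rewrite (@lt_geF _ _ b a); last lra
            | case: (leP a b) => [?|]; [| lower a; move=> ?] ]
  end; try lra.

Section GroupB.
Variable R : realType.
Implicit Types x y : R.

Definition alpha_fun x : R :=
  if x < 0 then x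
  else if x < 1/4 then 1/4 * x
  else if x < 7/16 then x - 3/16
  else if x < 9/16 then 4 * x - 3/2
  else if x < 3/4 then x + 3/16
  else if x <= 1 then 1/4 * x + 3/4
  else x.

Definition beta0_fun x : R :=
  if x < 7/16 then x
  else if x < 15/32 then 2 * x - 7/16
  else if x < 1/2 then x + 1/32
  else if x < 9/16 then 1/2 * x + 9/32
  else x.

Definition alpha_inv x : R :=
  if x < 1/16 then 4 * x
  else if x < 1/4 then x + 3/16
  else if x < 3/4 then 1/4 * x + 3/8
  else if x < 15/16 then x - 3/16
  else 4 * x - 3.

Definition beta0_inv x : R :=
  if x < 7/16 then x
  else if x < 1/2 then 1/2 * x + 7/32
  else if x < 17/32 then x - 1/32
  else if x < 9/16 then 2 * x - 9/16
  else x.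

Fact alpha_incr x y : 0 <= x -> x < y -> y <= 1 -> alpha_fun x < alpha_fun y.
Proof. by rewrite /alpha_fun => x0 xy y1; split_ifs. Qed.

Fact alpha_breaks : finitely_many_breaks alpha_fun.
Proof.
exists [:: 1/4; 7/16; 9/16; 3/4] => a b a0 ab b1 nobrk.
have sep c : c \in [:: 1/4; 7/16; 9/16; 3/4] -> b <= c \/ c <= a.
  move=> /nobrk nc; have [bc|cb] := leP b c; first by left.
  by right; rewrite leNgt; apply/negP => ac; apply: nc; rewrite ac.
have [h1|h1] := sep (1/4) ltac:(by rewrite !inE eqxx ?orbT).
  exists (1/4), 0 => x /andP[ax xb].
  move: (le_trans a0 ax) (le_trans xb h1) => {sep a0 ab b1 nobrk ax xb h1} ? ?.
  by rewrite /alpha_fun; split_ifs.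
have [h2|h2] := sep (7/16) ltac:(by rewrite !inE eqxx ?orbT).
  exists 1, (- (3/16)) => x /andP[ax xb].
  move: (le_trans h1 ax) (le_trans xb h2) => {sep a0 ab b1 nobrk ax xb h1 h2} ? ?.
  by rewrite /alpha_fun; split_ifs.
have [h3|h3] := sep (9/16) ltac:(by rewrite !inE eqxx ?orbT).
  exists 4, (- (3/2)) => x /andP[ax xb].
  move: (le_trans h2 ax) (le_trans xb h3) => {sep a0 ab b1 nobrk ax xb h1 h2 h3} ? ?.
  by rewrite /alpha_fun; split_ifs.
have [h4|h4] := sep (3/4) ltac:(by rewrite !inE eqxx ?orbT).
  exists 1, (3/16) => x /andP[ax xb].
  move: (le_trans h3 ax) (le_trans xb h4) => {sep a0 ab b1 nobrk ax xb h1 h2 h3 h4} ? ?.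
  by rewrite /alpha_fun; split_ifs.
exists (1/4), (3/4) => x /andP[ax xb].
move: (le_trans h4 ax) (le_trans xb b1) => {sep a0 ab b1 nobrk ax xb h1 h2 h3 h4} ? ?.
by rewrite /alpha_fun; split_ifs.
Qed.

Lemma alpha_is_plo : is_plo alpha_fun.
Proof.
split; last exact: alpha_breaks; last exact: alpha_incr.
- move=> x /negP; rewrite negb_and -!ltNge /alpha_fun => /orP[]?; split_ifs.
- exists alpha_inv; apply: homeomorphism_onI; last exact: alpha_incr.
  + by rewrite /alpha_fun => x /andP[x0 x1]; split_ifs.
  + by rewrite /alpha_inv => x /andP[x0 x1]; split_ifs.
  + by rewrite /alpha_fun => x /andP[x0 x1]; split_ifs; rewrite /alpha_inv; split_ifs.
  + by rewrite /alpha_inv => x /andP[x0 x1]; split_ifs; rewrite /alpha_fun; split_ifs.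
Qed.

Fact beta0_incr x y : 0 <= x -> x < y -> y <= 1 -> beta0_fun x < beta0_fun y.
Proof. by rewrite /beta0_fun => x0 xy y1; split_ifs. Qed.

Fact beta0_breaks : finitely_many_breaks beta0_fun.
Proof.
exists [:: 7/16; 15/32; 1/2; 9/16] => a b a0 ab b1 nobrk.
have sep c : c \in [:: 7/16; 15/32; 1/2; 9/16] -> b <= c \/ c <= a.
  move=> /nobrk nc; have [bc|cb] := leP b c; first by left.
  by right; rewrite leNgt; apply/negP => ac; apply: nc; rewrite ac.
have [h1|h1] := sep (7/16) ltac:(by rewrite !inE eqxx ?orbT).
  exists 1, 0 => x /andP[ax xb].
  move: (le_trans a0 ax) (le_trans xb h1) => {sep a0 ab b1 nobrk ax xb h1} ? ?.
  by rewrite /beta0_fun; split_ifs.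
have [h2|h2] := sep (15/32) ltac:(by rewrite !inE eqxx ?orbT).
  exists 2, (- (7/16)) => x /andP[ax xb].
  move: (le_trans h1 ax) (le_trans xb h2) => {sep a0 ab b1 nobrk ax xb h1 h2} ? ?.
  by rewrite /beta0_fun; split_ifs.
have [h3|h3] := sep (1/2) ltac:(by rewrite !inE eqxx ?orbT).
  exists 1, (1/32) => x /andP[ax xb].
  move: (le_trans h2 ax) (le_trans xb h3) => {sep a0 ab b1 nobrk ax xb h1 h2 h3} ? ?.
  by rewrite /beta0_fun; split_ifs.
have [h4|h4] := sep (9/16) ltac:(by rewrite !inE eqxx ?orbT).
  exists (1/2), (9/32) => x /andP[ax xb].
  move: (le_trans h3 ax) (le_trans xb h4) => {sep a0 ab b1 nobrk ax xb h1 h2 h3 h4} ? ?.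
  by rewrite /beta0_fun; split_ifs.
exists 1, 0 => x /andP[ax xb].
move: (le_trans h4 ax) (le_trans xb b1) => {sep a0 ab b1 nobrk ax xb h1 h2 h3 h4} ? ?.
by rewrite /beta0_fun; split_ifs.
Qed.

Lemma beta0_is_plo : is_plo beta0_fun.
Proof.
split; last exact: beta0_breaks; last exact: beta0_incr.
- move=> x /negP; rewrite negb_and -!ltNge /beta0_fun => /orP[]?; split_ifs.
- exists beta0_inv; apply: homeomorphism_onI; last exact: beta0_incr.
  + by rewrite /beta0_fun => x /andP[x0 x1]; split_ifs.
  + by rewrite /beta0_inv => x /andP[x0 x1]; split_ifs.
  + by rewrite /beta0_fun => x /andP[x0 x1]; split_ifs; rewrite /beta0_inv; split_ifs.
  + by rewrite /beta0_inv => x /andP[x0 x1]; split_ifs; rewrite /beta0_fun; split_ifs.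
Qed.

Definition alpha : PLo R := MkPLo alpha_is_plo.
Definition beta0 : PLo R := MkPLo beta0_is_plo.

Definition B : set (PLo R) := generated [set alpha; beta0].

End GroupB.

Arguments alpha R : clear implicits.
Arguments beta0 R : clear implicits.
Arguments B R : clear implicits.

(* Main.v *)
Require Import Defs.
From HB Require Import structures.
From mathcomp Require Import all_boot all_order all_algebra.
From mathcomp Require Import all_classical all_reals all_analysis.
From mathcomp Require Import zify ring lra.

(** Write [y ^ z] for the conjugate [z^-1 * y * z]. Call a pair [(x, y)] layered if the
    group generated by the conjugates [y ^ (x ^- i)], [i > 0], commutes elementwise with
    its conjugates by the positive powers of [y]. The pair [(alpha, beta0)] is layered:
    [alpha] repels its fixed point [1/2], so the conjugates of [beta0] are supported in a
    small neighbourhood of [1/2], which [beta0] moves off itself.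

    A layered pair in which [y] and [y ^ x^-1] do not commute determines the group that it
    generates ([layered_isomorphic]). Indeed a morphism that keeps the latter property is
    injective on this group ([layered_rigid]): the group is an ascending union of iterated
    wreath products with infinite cyclic groups, extended by a shift, and an element with
    central image is seen to be trivial layer after layer. Applied to both projections of
    the subgroup of a product generated by a pair of such pairs, this makes the subgroup
    the graph of an isomorphism. So it suffices to find such a pair in [H].

    The first step is an expander in [H] ([chain_has_expander]): elements [x] and [y] that
    fix [s < t], where [x] moves points away from the hull [[f1, fm]] of the fixed points
    that it has between [s] and [t], and [y] moves this hull off itself. Let [(s, t)] be
    the component of the support of the group of [g] and [h] that contains the chain. If
    an element [x] of the group moves points to the left near [s] and to the right near
    [t], then it serves, as orbits in [(s, t)] are unbounded. Otherwise [g] or [h], or its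
    inverse, is some [k] that moves points to the right near [s] and near [t] and has a
    fixed point in between. A commutator [l] with trivial germs at [s] and [t] displaces
    the fixed points of [k], and [l] and its conjugate by a large power of [k] act near
    the ends of a common orbital independently ([same_direction_expander]).

    It remains to control the other orbitals of the group of [x] and [y]. Choose [y] such
    that it moves as few points as possible of the finite frontier of the fixed set of
    [x]. If the orbital of a moved frontier point is not repelled by [x] towards both
    ends, then some conjugate of a commutator fixes this point and still displaces
    [[f1, fm]], against the choice of [y] ([minimal_ends]). Hence in each orbital [x]
    either repels the hull of its fixed points, or has no fixed points, or is the
    identity. Commutators have trivial germs at the ends of all orbitals, and one
    element [v] with such germs displaces all these hulls at once
    ([simultaneous_displacement]). For a large power [X] of [x] the pair [(X, v)] is then
    layered: in orbitals of the first kind the conjugates of [v] live near the hull, and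
    in the others they commute ([good_regions_layered], [expander_layered_pair]). *)

Set Implicit Arguments.
Unset Strict Implicit.
Unset Printing Implicit Defensive.

Import Order.TTheory GRing.Theory Num.Theory.
Import numFieldNormedType.Exports.

Local Open Scope classical_set_scope.

(** * Generated subgroups *)

Section Generation.
Local Open Scope group_scope.
Variable gT : groupType.
Implicit Types (G K S : set gT) (P : gT -> Prop) (a b t z : gT) (i j n : nat).

Lemma subgroup1 G : is_subgroup G -> G 1.
Proof. by case; rewrite inE. Qed.

Lemma subgroupV G a : is_subgroup G -> G a -> G a^-1.
Proof.
move=> /group_closedV GV Ga.
by have := GV a; rewrite !inE; apply.
Qed.

Lemma subgroupM G a b : is_subgroup G -> G a -> G b -> G (a * b).
Proof.
move=> /group_closedM GM Ga Gb.
by have := GM a b; rewrite !inE; apply.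
Qed.

Lemma subgroupX G a n : is_subgroup G -> G a -> G (a ^+ n).
Proof.
move=> sG Ga; elim: n => [|n IHn]; first exact: subgroup1.
by rewrite expgS; apply: subgroupM.
Qed.

Lemma subgroupJ G a b : is_subgroup G -> G a -> G b -> G (a ^ b).
Proof.
by move=> sG Ga Gb; rewrite conjgE; do 2?apply: subgroupM; rewrite //; apply: subgroupV.
Qed.

Lemma subgroupI G : G 1 -> (forall a b, G a -> G b -> G (a * b)) ->
  (forall a, G a -> G a^-1) -> is_subgroup G.
Proof.
move=> G1 GM GV; split; first by rewrite inE.
by move=> a b; rewrite !inE => Ga Gb; apply/GM/GV.
Qed.

Lemma generated_subgroup S : is_subgroup (generated S).
Proof.
apply: subgroupI => [K [sK _]|a b Ga Gb K sK|a Ga K sK].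
- exact: subgroup1.
- by apply: subgroupM; [case: sK | apply: Ga | apply: Gb].
- by apply: subgroupV; [case: sK | apply: Ga].
Qed.

Lemma sub_generated S : S `<=` generated S.
Proof. by move=> z Sz K [_]; apply. Qed.

Lemma generated_sub S K : is_subgroup K -> S `<=` K -> generated S `<=` K.
Proof. by move=> sK SK z; apply. Qed.

Lemma generated_ind S P : P 1 -> (forall a b, P a -> P b -> P (a * b)) ->
  (forall a, P a -> P a^-1) -> (forall a, S a -> P a) ->
  forall z, generated S z -> P z.
Proof. by move=> P1 PM PV SP; apply: generated_sub => //; apply: subgroupI. Qed.

Lemma commuteJ a b t : commute a b -> commute (a ^ t) (b ^ t).
Proof. by rewrite /commute -!conjMg => ->. Qed.

Lemma commuteJE a t : commute a t -> a ^ t = a.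
Proof. by move=> c; rewrite conjgE c mulKg. Qed.

(** Positive powers of [t] move to the left across [K], negative ones to the
    right, which sorts any word. *)
Lemma generated_normal_form K t : is_subgroup K -> (forall u, K u -> K (u ^ t)) ->
  forall z, generated (t |` K) z ->
  exists i j u, K u /\ z = t ^+ i * u * t ^- j.
Proof.
move=> sK Kt; have KtX n u : K u -> K (u ^ (t ^+ n)).
  by elim: n u => [|n IHn] u Ku; rewrite ?expg0 ?conjg1 // expgS conjgM; auto.
apply: generated_ind.
- by exists 0%N, 0%N, 1; split; [apply: (subgroup1 sK) | rewrite !mul1g expg0 invg1].
- move=> _ _ [a [b [u [Ku ->]]]] [a' [b' [u' [Ku' ->]]]].
  have [le|/ltnW le] := leqP b a'.
    exists (a + (a' - b)), b', (u ^ (t ^+ (a' - b)) * u').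
    split; first by apply: (subgroupM sK) => //; apply: KtX.
    rewrite -{1}(subnKC le) !expgnDr !conjgE !mulgA.
    by rewrite (mulgK (t ^+ (a' - b))) (mulgVK (t ^+ b)).
  exists a, (b' + (b - a')), (u * u' ^ (t ^+ (b - a'))).
  split; first by apply: (subgroupM sK) => //; apply: KtX.
  rewrite -{1}(subnKC le) !expgnDr !invgM !conjgE !mulgA.
  by rewrite (mulgVK (t ^+ a')) (mulgK (t ^+ (b - a'))).
- move=> _ [a [b [u [Ku ->]]]]; exists b, a, u^-1.
  by split; [apply: (subgroupV sK) | rewrite !invgM invgK mulgA].
- move=> z /= [->|Kz].
    by exists 1%N, 0%N, 1; split; [apply: (subgroup1 sK) | rewrite expg0 invg1 !mulg1].
  by exists 0%N, 0%N, z; split=> //; rewrite expg0 invg1 mulg1 mul1g.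
Qed.

End Generation.

(** * Rigidity of layered pairs *)

Section Layered.
Local Open Scope group_scope.
Variable gT : groupType.
Implicit Types (x y u v w z : gT) (A : set gT).

(** The group generated by the conjugates [x ^+ i.+1 * y * x ^- i.+1]. Conjugation by
    [x^-1] maps it into itself, and conjugation by [x] enlarges it by one layer, the
    group generated by [y]. *)
Definition lower x y : set gT := generated [set y ^ (x ^- i.+1) | i in setT].

(** The subgroup of [lower x y] generated by its first [n] generators. *)
Definition lower_upto x y n : set gT :=
  generated [set y ^ (x ^- i.+1) | i in [set i | (i < n)%N]].

(** The conjugates of [lower x y] by distinct powers of [y] commute elementwise, as
    in a restricted wreath product with the cyclic group generated by [y]. Exponents
    start at [1]; negative ones follow by conjugation. *)
Definition layered x y := forall u w p, lower x y u -> lower x y w ->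
  commute (u ^ (y ^+ p.+1)) w.

Lemma lower_uptoW x y n : lower_upto x y n `<=` lower x y.
Proof.
apply: generated_sub; first exact: generated_subgroup.
by move=> _ [i _ <-]; apply: sub_generated; exists i.
Qed.

Lemma lower_subgroup x y : is_subgroup (lower x y).
Proof. exact: generated_subgroup. Qed.

Lemma lower_conjV x y w : lower x y w -> lower x y (w ^ x^-1).
Proof.
have sL := lower_subgroup x y.
refine (@generated_ind _ _ (fun w => lower x y (w ^ x^-1)) _ _ _ _ w).
- by rewrite conj1g; apply: (subgroup1 sL).
- by move=> a b ? ?; rewrite conjMg; apply: (subgroupM sL).
- by move=> a ?; rewrite conjVg; apply: (subgroupV sL).
- move=> _ [i _ <-]; apply: sub_generated; exists i.+1 => //.
  by rewrite -conjgM -invgM -expgS.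
Qed.

Lemma lower_y x y i : lower x y (y ^ (x ^- i.+1)).
Proof. by apply: sub_generated; exists i. Qed.

Lemma lower_upto_conj x y n u : lower_upto x y n.+1 u ->
  generated (y |` lower_upto x y n) (u ^ x).
Proof.
set K := generated (y |` _); have sK : is_subgroup K by apply: generated_subgroup.
refine (@generated_ind _ _ (fun u => K (u ^ x)) _ _ _ _ u).
- by rewrite conj1g; apply: (subgroup1 sK).
- by move=> a b ? ?; rewrite conjMg; apply: (subgroupM sK).
- by move=> a ?; rewrite conjVg; apply: (subgroupV sK).
- move=> _ [[|i] /= ilt <-].
    by rewrite expg1 conjgKV; apply: sub_generated; left.
  apply: sub_generated; right; apply: sub_generated; exists i => //.
  by rewrite (expgS x i.+1) invgM conjgM conjgKV.
Qed.

(** The elements [v_0 * v_1 ^ y * v_2 ^ (y ^+ 2) * ...] with the [v_i] in [A],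
    written by Horner's scheme. *)
Inductive horner A y : gT -> Prop :=
| Horner1 : horner A y 1
| HornerS v s : A v -> horner A y s -> horner A y (v * s ^ y).

Section HornerTheory.
Variables (x y : gT) (A : set gT).
Hypotheses (lay : layered x y) (sA : is_subgroup A) (Alow : A `<=` lower x y).

Lemma horner_commute z : horner A y z -> forall w, lower x y w ->
  forall p, commute (z ^ (y ^+ p.+1)) w.
Proof.
elim=> [|v s Av _ IH] w lw p; first by rewrite conj1g; apply/commute_sym/commute1.
rewrite conjMg; apply/commute_sym/commuteM; apply/commute_sym.
  by apply: lay => //; apply: Alow.
by rewrite -conjgM -expgS; apply: IH.
Qed.

Lemma horner_commute_far z : horner A y z ->
  exists N, forall w, lower x y w -> commute z (w ^ (y ^+ N)).
Proof.
elim=> [|v s Av _ [N IH]]; first by exists 0%N => w _; apply/commute_sym/commute1.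
exists N.+1 => w lw; apply/commute_sym/commuteM.
  by apply: lay => //; apply: Alow.
by rewrite expgSr conjgM; apply/commuteJ/commute_sym/IH.
Qed.

Lemma horner_conj z : horner A y z -> horner A y (z ^ y).
Proof. by move=> hz; rewrite -[z ^ y]mul1g; apply: HornerS => //; apply: (subgroup1 sA). Qed.

Lemma horner_subgroup : is_subgroup (horner A y).
Proof.
apply: subgroupI; first exact: Horner1.
- move=> a b ha; elim: ha b => [|v s Av hs IH] b hb; first by rewrite mul1g.
  case: hb => [|w t Aw ht]; first by rewrite mulg1; apply: HornerS.
  have -> : v * s ^ y * (w * t ^ y) = v * w * (s * t) ^ y.
    have := horner_commute hs (Alow Aw) 0%N; rewrite expg1 conjMg.
    by move: (s ^ y) (t ^ y) => p q c; rewrite !mulgA -(mulgA v p) c !mulgA.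
  by apply: HornerS; [apply: (subgroupM sA) | apply: IH].
- move=> a; elim=> [|v s Av hs IH]; first by rewrite invg1; apply: Horner1.
  have -> : (v * s ^ y)^-1 = v^-1 * s^-1 ^ y.
    have := horner_commute hs (Alow Av) 0%N; rewrite expg1 => c.
    by rewrite -c invgM conjVg.
  by apply: HornerS => //; apply: (subgroupV sA).
Qed.

End HornerTheory.

End Layered.

(** A morphism defined on the group of a layered pair is injective there as soon as
    the images of [y] and [y ^ x^-1] do not commute. *)
Section Rigidity.
Local Open Scope group_scope.
Variables (gT hT : groupType) (phi : gT -> hT).
Hypothesis phiM : {morph phi : u v / u * v}.
Variables x y : gT.
Hypothesis lay : layered x y.
Hypothesis ncom : ~ commute (phi y) (phi y ^ (phi x)^-1).
Implicit Types (u v w z : gT).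

Let A := lower x y.
Let sA : is_subgroup A. Proof. exact: generated_subgroup. Qed.

Let phi1 : phi 1 = 1.
Proof. by apply: (@mulgI _ (phi 1)); rewrite -phiM !mulg1. Qed.

Let phiV u : phi u^-1 = (phi u)^-1.
Proof. by apply/esym/mulg1_eq; rewrite -phiM mulgV phi1. Qed.

Let phiJ u v : phi (u ^ v) = phi u ^ phi v.
Proof. by rewrite !conjgE !phiM phiV. Qed.

Let phi_com u v : commute u v -> commute (phi u) (phi v).
Proof. by rewrite /commute -!phiM => ->. Qed.

(* An abelian image would contain commuting images of [y ^ x^-1] and [y ^ (x ^- 2)],
   whose conjugates by [phi x] are the two elements of [ncom]. *)
Let lower_nonabelian : ~ (forall u w, A u -> A w -> commute (phi u) (phi w)).
Proof.
move=> ab; apply: ncom.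
have := ab _ _ (@lower_y _ x y 0%N) (@lower_y _ x y 1%N).
rewrite (expgS x 1) expg1 invgM conjgM !phiJ phiV.
by move/(@commuteJ _ _ _ (phi x)); rewrite !conjgKV.
Qed.

(* A power of [y] with such an image would centralise the image of [lower x y], while
   it conjugates this image to a group that commutes with it. *)
Let power_not_commute c N :
  ~ (forall u, A u -> commute (phi (y ^+ c.+1)) (phi (u ^ (y ^+ N)))).
Proof.
move=> com; apply: lower_nonabelian => u w Au Aw.
have cu : commute (phi u) (phi (y ^+ c.+1)).
  have -> : phi u = phi (u ^ (y ^+ N)) ^ phi (y ^- N) by rewrite -phiJ conjgK.
  have -> : phi (y ^+ c.+1) = phi (y ^+ c.+1) ^ phi (y ^- N).
    by rewrite -phiJ commuteJE //; apply/commuteV/commute_sym/commuteX/commute_sym/commuteX.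
  exact/commuteJ/commute_sym/com.
by rewrite -(commuteJE cu) -phiJ; apply/phi_com/lay.
Qed.

(* The image of [u] centralises the image of [lower x y]. *)
Let central u := (forall w, A w -> commute (phi u) (phi w)).

(** By descent on the number of layers: the layered relations write a conjugate
    of [u] as a power of [y] times commuting coordinates; the power is trivial
    because [phi] maps [lower x y] to a nonabelian group, and each coordinate
    has a central image and fewer layers. *)
Lemma central_image_trivial n u : lower_upto x y n u -> central u -> u = 1.
Proof.
elim: n u => [|n IHn] u.
  move=> uP _; move: uP; refine (@generated_ind _ _ (fun u => u = 1) _ _ _ _ u) => //.
  - by move=> ? ? -> ->; rewrite mul1g.
  - by move=> ? ->; rewrite invg1.
  - by move=> ? [i].
move=> /lower_upto_conj uxP cu.
have cuA w : A w -> commute (phi (u ^ x)) (phi w).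
  move=> Aw; rewrite -[w](conjgKV x) (phiJ u) (phiJ (w ^ x^-1)).
  by apply: commuteJ; apply: cu; apply: lower_conjV.
have cuy : commute (phi (u ^ x)) (phi y).
  rewrite -[y](conjgKV x) (phiJ u) (phiJ (y ^ x^-1)); apply: commuteJ.
  by apply: cu; have := @lower_y _ x y 0%N; rewrite expg1.
set K := lower_upto x y n in uxP; have sK : is_subgroup K by apply: generated_subgroup.
have KA : K `<=` A by apply: lower_uptoW.
have [|a [b [z [hz uxE]]]] := generated_normal_form (horner_subgroup lay sK KA)
    (horner_conj sK) (z := u ^ x) (t := y).
  apply: generated_sub uxP; first exact: generated_subgroup.
  move=> w [->|Kw]; apply: sub_generated; [by left|right].
  by rewrite -[w]mulg1 -(conj1g y); apply: HornerS => //; apply: Horner1.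
have cuyX m : commute (phi (u ^ x)) (phi (y ^+ m)).
  elim: m => [|m IHm]; first by rewrite expg0 phi1; apply: commute1.
  by rewrite expgS (phiM y); apply: commuteM.
have uxE' : phi (u ^ x) = phi (z * (y ^- b * y ^+ a)).
  rewrite -(commuteJE (cuyX a)) -phiJ uxE; congr phi.
  by rewrite conjgE !mulgA mulVg mul1g.
have [N far] := horner_commute_far lay KA hz.
have com w : A w -> commute (phi (y ^- b * y ^+ a)) (phi (w ^ (y ^+ N))).
  move=> Aw; apply/commute_sym.
  have -> : phi (y ^- b * y ^+ a) = (phi z)^-1 * phi (u ^ x).
    by rewrite uxE' (phiM z) mulKg.
  apply: commuteM; first by apply/commuteV/commute_sym/phi_com/far.
  apply/commute_sym; rewrite (phiJ w) conjgE; apply: commuteM.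
    exact/commuteV.
  by apply: commuteM => //; apply: cuA.
(* Far conjugates of [lower x y] commute with [z] and with [u ^ x], hence with the
   remaining power of [y], which must therefore be trivial. *)
have ab : a = b.
  have [lt|lt|//] := ltngtP a b; exfalso.
    apply: (@power_not_commute (b - a).-1 N) => w Aw.
    rewrite prednK ?subn_gt0 //; apply/commute_sym.
    rewrite -[phi (y ^+ _)]invgK -phiV; apply/commuteV/commute_sym.
    have -> : y ^- (b - a) = y ^- b * y ^+ a; last exact: com.
    by rewrite -{2}(subnKC (ltnW lt)) expgnDr invgM mulgVK.
  apply: (@power_not_commute (a - b).-1 N) => w Aw.
  rewrite prednK ?subn_gt0 //.
  have -> : y ^+ (a - b) = y ^- b * y ^+ a; last exact: com.
  by rewrite -{2}(subnKC (ltnW lt)) expgnDr mulKg.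
have {}uxE' : phi (u ^ x) = phi z by rewrite uxE' ab mulVg mulg1.
rewrite uxE' in cuA cuy.
(* The coordinates of [z] are peeled off one at a time: the first one commutes with
   [lower x y] modulo the kernel because [z] does and the others do. *)
have z1 : z = 1.
  elim: hz cuA cuy {uxE uxE' far com} => [//|v s Kv hs IHs] cA cy.
  have v1 : v = 1.
    apply: IHn => // w Aw.
    have -> : phi v = phi (v * s ^ y) * phi (s ^ y)^-1 by rewrite -phiM mulgK.
    apply/commute_sym/commuteM; first exact/commute_sym/cA.
    rewrite phiV; apply/commuteV/commute_sym/phi_com.
    by have := horner_commute lay KA hs Aw 0%N; rewrite expg1.
  rewrite {}v1 mul1g in cA cy *.
  have sE : phi s = phi (s ^ y).
    rewrite -[in LHS](conjgK y s) phiJ; apply: commuteJE.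
    by rewrite phiV; apply: commuteV.
  by rewrite IHs ?conj1g // sE.
rewrite z1 ab mulg1 mulgV in uxE.
by apply/eqP; rewrite -(conjg_eq1 u x) uxE.
Qed.

Lemma lower_upto_mono m n : (m <= n)%N -> lower_upto x y m `<=` lower_upto x y n.
Proof.
move=> le; apply: generated_sub; first exact: generated_subgroup.
by move=> _ [i /= im <-]; apply: sub_generated; exists i => //=; apply: leq_trans le.
Qed.

Lemma lower_ex_upto u : A u -> exists n, lower_upto x y n u.
Proof.
refine (@generated_ind _ _ (fun u => exists n, lower_upto x y n u) _ _ _ _ u).
- by exists 0%N; exact: subgroup1 (generated_subgroup _).
- move=> a b [m am] [n bn]; exists (maxn m n).
  apply: (subgroupM (generated_subgroup _)).
    exact: lower_upto_mono (leq_maxl _ _) _ am.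
  exact: lower_upto_mono (leq_maxr _ _) _ bn.
- by move=> a [n an]; exists n; apply: (subgroupV (generated_subgroup _)).
- by move=> _ [i _ <-]; exists i.+1; apply: sub_generated; exists i => /=.
Qed.

(* If a power of [phi x] were the image of some [u] in [lower x y], then conjugation by
   [u] would show that [phi y] is the image of an element [q] of [lower x y], which
   normalises [lower x y]; being layered would make the image abelian. *)
Let power_not_image c u : A u -> phi u <> (phi x) ^+ c.+1.
Proof.
move=> Au uE; pose q := (y ^ (x ^- c.+1)) ^ u.
have Aq : A q by apply: (subgroupJ sA) => //; apply: lower_y.
have phiX m : phi (x ^+ m) = phi x ^+ m.
  by elim: m => [|m IHm]; rewrite ?expg0 // !expgS phiM IHm.
have qE : phi q = phi y by rewrite !phiJ uE phiV phiX conjgKV.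
apply: lower_nonabelian => v w Av Aw.
have -> : phi v = phi ((v ^ q^-1) ^ y) by rewrite !phiJ -qE phiV conjgKV.
have := @lay (v ^ q^-1) w 0%N; rewrite expg1 => h; apply/phi_com/h => //.
by apply: (subgroupJ sA) => //; apply: (subgroupV sA).
Qed.

Theorem layered_rigid z : generated [set x; y] z -> phi z = 1 -> z = 1.
Proof.
move=> zxy; have {zxy} : generated (x^-1 |` A) z.
  apply: generated_sub zxy; first exact: generated_subgroup.
  have gx : generated (x^-1 |` A) x.
    rewrite -[x]invgK; apply: (subgroupV (generated_subgroup _)).
    by apply: sub_generated; left; rewrite /= invgK.
  move=> w [->//|->]; rewrite -[y](conjgKV x).
  apply: (subgroupJ (generated_subgroup _)) => //.
  apply: sub_generated; right.
  by have := @lower_y _ x y 0%N; rewrite expg1.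
move=> /(generated_normal_form sA (@lower_conjV _ x y))[a [b [u [Au ->]]]].
have phiX t m : phi (t ^+ m) = phi t ^+ m.
  by elim: m => [|m IHm]; rewrite ?expg0 // !expgS phiM IHm.
rewrite !phiM !phiV !phiX !phiV !expVgn !invgK => uE.
have {}uE : phi u = phi x ^+ a * phi x ^- b.
  by rewrite -[phi u](mulKg (phi x ^- a)) invgK -[_ * phi u](mulgK (phi x ^+ b)) uE mul1g.
have [lt|lt|ab] := ltngtP a b.
- have [] := @power_not_image (b - a).-1 u^-1; first exact: (subgroupV sA).
  rewrite phiV uE prednK ?subn_gt0 // invgM invgK.
  by rewrite -{1}(subnK (ltnW lt)) expgnDr mulgK.
- have [] := @power_not_image (a - b).-1 u => //.
  by rewrite uE prednK ?subn_gt0 // -{1}(subnK (ltnW lt)) expgnDr mulgK.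
have [n un] := lower_ex_upto Au.
have -> : u = 1.
  apply: (central_image_trivial un) => w _.
  by rewrite uE ab mulgV; apply/commute_sym/commute1.
by rewrite ab mulg1 mulVg.
Qed.

End Rigidity.

Section LayeredIsomorphic.
Local Open Scope group_scope.
Variables gT hT : groupType.

Lemma generated_fst (S : set (gT * hT)) d : generated S d ->
  generated [set s.1 | s in S] d.1.
Proof.
have sG := generated_subgroup [set s.1 | s in S].
refine (@generated_ind _ _ (fun d => generated [set s.1 | s in S] d.1) _ _ _ _ d).
- exact: (subgroup1 sG).
- by move=> a b ? ?; apply: (subgroupM sG).
- by move=> a ?; apply: (subgroupV sG).
- by move=> a Sa; apply: sub_generated; exists a.
Qed.

Lemma generated_snd (S : set (gT * hT)) d : generated S d ->
  generated [set s.2 | s in S] d.2.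
Proof.
have sG := generated_subgroup [set s.2 | s in S].
refine (@generated_ind _ _ (fun d => generated [set s.2 | s in S] d.2) _ _ _ _ d).
- exact: (subgroup1 sG).
- by move=> a b ? ?; apply: (subgroupM sG).
- by move=> a ?; apply: (subgroupV sG).
- by move=> a Sa; apply: sub_generated; exists a.
Qed.

Lemma expg_pair (d : gT * hT) n : d ^+ n = (d.1 ^+ n, d.2 ^+ n).
Proof. by elim: n => // n IHn; rewrite !expgS IHn. Qed.

Lemma layered_pair (x y : gT) (x' y' : hT) : layered x y -> layered x' y' ->
  layered (x, x') (y, y').
Proof.
move=> lay lay' u w p lu lw.
have E i : (y, y') ^ ((x, x') ^- i.+1) = (y ^ (x ^- i.+1), y' ^ (x' ^- i.+1)).
  by rewrite expg_pair.
have lower1 d : lower (x, x') (y, y') d -> lower x y d.1.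
  move/generated_fst; apply: generated_sub; first exact: generated_subgroup.
  by move=> _ [_ [i _ <-] <-]; rewrite E; apply: lower_y.
have lower2 d : lower (x, x') (y, y') d -> lower x' y' d.2.
  move/generated_snd; apply: generated_sub; first exact: generated_subgroup.
  by move=> _ [_ [i _ <-] <-]; rewrite E; apply: lower_y.
rewrite expg_pair; apply/pair_equal_spec; split.
  by apply: lay; apply: lower1.
by apply: lay'; apply: lower2.
Qed.

(** The subgroup of the product generated by the pair of pairs is the graph of
    the isomorphism: by rigidity, both projections are injective on it. *)
Theorem layered_isomorphic (x y : gT) (x' y' : hT) : layered x y -> layered x' y' ->
  ~ commute y (y ^ x^-1) -> ~ commute y' (y' ^ x'^-1) ->
  isomorphic (generated [set x; y]) (generated [set x'; y']).
Proof.
move=> lay lay' nc nc'.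
pose D := generated [set (x, x'); (y, y')].
have sD : is_subgroup D by apply: generated_subgroup.
have D1 d : D d -> d.1 = 1 -> d = 1.
  exact: (@layered_rigid _ _ fst _ _ _ (layered_pair lay lay')).
have D2 d : D d -> d.2 = 1 -> d = 1.
  exact: (@layered_rigid _ _ snd _ _ _ (layered_pair lay lay')).
have inj1 d e : D d -> D e -> d.1 = e.1 -> d = e.
  move=> Dd De E; apply: divg1_eq; apply: D1.
    by apply: (subgroupM sD) => //; apply: (subgroupV sD).
  by rewrite /= E mulgV.
have inj2 d e : D d -> D e -> d.2 = e.2 -> d = e.
  move=> Dd De E; apply: divg1_eq; apply: D2.
    by apply: (subgroupM sD) => //; apply: (subgroupV sD).
  by rewrite /= E mulgV.
have surj1 b : generated [set x; y] b -> exists2 d, D d & d.1 = b.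
  refine (@generated_ind _ _ (fun b => exists2 d, D d & d.1 = b) _ _ _ _ b).
  - by exists 1 => //; apply: (subgroup1 sD).
  - by move=> _ _ [d Dd <-] [e De <-]; exists (d * e) => //; apply: (subgroupM sD).
  - by move=> _ [d Dd <-]; exists d^-1 => //; apply: (subgroupV sD).
  - by move=> _ [->|->]; [exists (x, x')|exists (y, y')] => //; apply: sub_generated;
      [left|right].
have surj2 b : generated [set x'; y'] b -> exists2 d, D d & d.2 = b.
  refine (@generated_ind _ _ (fun b => exists2 d, D d & d.2 = b) _ _ _ _ b).
  - by exists 1 => //; apply: (subgroup1 sD).
  - by move=> _ _ [d Dd <-] [e De <-]; exists (d * e) => //; apply: (subgroupM sD).
  - by move=> _ [d Dd <-]; exists d^-1 => //; apply: (subgroupV sD).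
  - by move=> _ [->|->]; [exists (x, x')|exists (y, y')] => //; apply: sub_generated;
      [left|right].
have DE1 d : D d -> generated [set x; y] d.1.
  move/generated_fst; apply: generated_sub; first exact: generated_subgroup.
  by move=> _ [_ [->|->] <-]; apply: sub_generated; [left|right].
have DE2 d : D d -> generated [set x'; y'] d.2.
  move/generated_snd; apply: generated_sub; first exact: generated_subgroup.
  by move=> _ [_ [->|->] <-]; apply: sub_generated; [left|right].
have [phi phiP] : exists phi : gT -> hT, forall d, D d -> phi d.1 = d.2.
  exists (fun b => if pselect (exists2 d, D d & d.1 = b) is left p
                   then (projT1 (cid2 p)).2 else 1) => d Dd.
  case: pselect => [p|[]]; last by exists d.
  by case: (cid2 p) => e De E /=; rewrite (inj1 _ _ De Dd E).
exists phi; first split.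
- by move=> b /surj1[d Dd <-]; rewrite /= phiP //; apply: DE2.
- move=> a b; rewrite !inE => /surj1[d Dd <-] /surj1[e De <-].
  by rewrite !phiP // => /(inj2 _ _ Dd De) ->.
- move=> b /surj2[d Dd <-]; exists d.1; last by rewrite phiP.
  exact: DE1.
- move=> a b; rewrite !inE => /surj1[d Dd <-] /surj1[e De <-].
  by rewrite !phiP //; rewrite -[d.1 * e.1]/((d * e).1) phiP //; apply: (subgroupM sD).
Qed.

End LayeredIsomorphic.

(** * Piecewise-linear homeomorphisms acting on the line *)

Section PLoBasics.
Variable R : realType.
Local Open Scope ring_scope.
Implicit Types (g h x y : PLo R) (a b c e s t z w : R) (n : nat) (S : set (PLo R)).

Lemma ploM g h z : (g * h)%g z = h (g z). Proof. by []. Qed.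
Lemma ploK g : cancel g (g^-1)%g. Proof. exact: (plo_invP g).1. Qed.
Lemma ploVK g : cancel (g^-1)%g g. Proof. exact: (plo_invP g).2. Qed.

Lemma plo_range g z : 0 <= z <= 1 -> 0 <= g z <= 1.
Proof. by case: (ploP g) => _ [k /homeomorphism_onE[gI _ _ _]] _ _; apply: gI. Qed.

Lemma plo_end0 g : g 0 = 0.
Proof.
have zI : 0 <= (0 : R) <= 1 by rewrite lexx ler01.
have /andP[g0 _] := plo_range g zI; have /andP[k0 k1] := plo_range (g^-1)%g zI.
apply/eqP; rewrite eq_le g0 andbT leNgt; apply/negP => gt0.
have : 0 < (g^-1)%g 0.
  rewrite lt_neqAle k0 andbT; apply/eqP => E.
  by have := ploVK g 0; rewrite -E => E0; move: gt0; rewrite E0 ltxx.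
by move=> /(plo_incr (ploP g) (lexx 0))/(_ k1); rewrite ploVK ltNge (ltW gt0).
Qed.

Lemma plo_end1 g : g 1 = 1.
Proof.
have zI : 0 <= (1 : R) <= 1 by rewrite lexx ler01.
have /andP[_ g1] := plo_range g zI; have /andP[k0 k1] := plo_range (g^-1)%g zI.
apply/eqP; rewrite eq_le g1 /= leNgt; apply/negP => lt1.
have : (g^-1)%g 1 < 1.
  rewrite lt_neqAle k1 andbT; apply/eqP => E.
  by have := ploVK g 1; rewrite E => E1; move: lt1; rewrite E1 ltxx.
by move=> /(plo_incr (ploP g) k0)/(_ (lexx 1)); rewrite ploVK ltNge (ltW lt1).
Qed.

Lemma plo_le0 g z : z <= 0 -> g z = z.
Proof.
rewrite le_eqVlt => /orP[/eqP->|z0]; first exact: plo_end0.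
by apply: (plo_out (ploP g)); rewrite leNgt z0.
Qed.

Lemma plo_ge1 g z : 1 <= z -> g z = z.
Proof.
rewrite le_eqVlt => /orP[/eqP<-|z1]; first exact: plo_end1.
by apply: (plo_out (ploP g)); rewrite [z <= 1]leNgt z1 andbF.
Qed.

Lemma plo_lt_homo g : {homo g : z w / z < w}.
Proof.
move=> z w zw; have [z0|z0] := leP z 0.
  rewrite (plo_le0 g z0); have [w0|w0] := leP w 0; first by rewrite plo_le0.
  have [w1|w1] := leP 1 w; first by rewrite plo_ge1.
  by apply: le_lt_trans z0 _; rewrite -(plo_end0 g) (plo_incr (ploP g)) // ltW.
have [w1|w1] := leP 1 w; last by rewrite (plo_incr (ploP g)) // ltW.
rewrite (plo_ge1 g w1); have [z1|z1] := leP 1 z; first by rewrite plo_ge1.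
by apply: lt_le_trans w1; rewrite -[ltRHS](plo_end1 g) (plo_incr (ploP g)) // ltW.
Qed.

Lemma plo_le g : {mono g : z w / z <= w}.
Proof. exact: le_mono (@plo_lt_homo g). Qed.

Lemma plo_lt g : {mono g : z w / z < w}.
Proof. exact: leW_mono (@plo_le g). Qed.

Lemma plo_inj g : injective g. Proof. exact: can_inj (ploK g). Qed.

Lemma plo_ltV g z w : ((g^-1)%g z < w) = (z < g w).
Proof. by rewrite -(plo_lt g) ploVK. Qed.
Lemma plo_Vlt g z w : (z < (g^-1)%g w) = (g z < w).
Proof. by rewrite -(plo_lt g) ploVK. Qed.
Lemma plo_leV g z w : ((g^-1)%g z <= w) = (z <= g w).
Proof. by rewrite -(plo_le g) ploVK. Qed.
Lemma plo_Vle g z w : (z <= (g^-1)%g w) = (g z <= w).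
Proof. by rewrite -(plo_le g) ploVK. Qed.

Lemma plo_fixV g z : g z = z -> (g^-1)%g z = z.
Proof. by move=> E; rewrite -{1}E ploK. Qed.

Lemma plo_fixX g n z : g z = z -> (g ^+ n)%g z = z.
Proof. by move=> E; elim: n => // n IHn; rewrite expgS ploM E. Qed.

Lemma ploXS g n z : (g ^+ n.+1)%g z = g ((g ^+ n)%g z).
Proof. by rewrite expgSr. Qed.

(** ** Germs at fixed points *)

Lemma next_point (l : seq R) e t : e < t ->
  exists b, [/\ e < b, b <= t, b \in t :: l & forall c, c \in l -> ~ (e < c < b)].
Proof.
move=> et; elim: l => [|c l [b [eb bt bl nb]]].
  by exists t; split=> //; rewrite inE eqxx.
have [/andP[ec cb]|ncb] := boolP (e < c < b).
  exists c; split=> //; first exact: le_trans (ltW cb) bt.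
    by rewrite !inE eqxx orbT.
  move=> d; rewrite inE => /orP[/eqP->|/nb ndb]; first by rewrite ltxx andbF.
  by move=> /andP[ed dc]; apply: ndb; rewrite ed (lt_trans dc cb).
exists b; split=> //; first by move: bl; rewrite !inE => /orP[->//|->]; rewrite !orbT.
by move=> d; rewrite inE => /orP[/eqP->|/nb//]; apply/negP.
Qed.

Lemma previous_point (l : seq R) e s : s < e ->
  exists b, [/\ b < e, s <= b, b \in s :: l & forall c, c \in l -> ~ (b < c < e)].
Proof.
move=> se; elim: l => [|c l [b [eb bt bl nb]]].
  by exists s; split=> //; rewrite inE eqxx.
have [/andP[ec cb]|ncb] := boolP (b < c < e).
  exists c; split=> //; first exact: le_trans bt (ltW ec).
    by rewrite !inE eqxx orbT.
  move=> d; rewrite inE => /orP[/eqP->|/nb ndb]; first by rewrite ltxx.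
  by move=> /andP[ed dc]; apply: ndb; rewrite dc (lt_trans ec ed).
exists b; split=> //; first by move: bl; rewrite !inE => /orP[->//|->]; rewrite !orbT.
by move=> d; rewrite inE => /orP[/eqP->|/nb//]; apply/negP.
Qed.

Lemma affine_slope_gt0 g a b m p : a < b ->
  (forall z, a <= z <= b -> g z = m * z + p) -> 0 < m.
Proof.
move=> ab aff; have := plo_lt g a b.
rewrite ab !aff ?lexx ?(ltW ab) // ltrD2r -subr_gt0 -mulrBr.
by rewrite pmulr_lgt0 // subr_gt0.
Qed.

Lemma germ_right g e : g e = e -> exists m d : R,
  [/\ 0 < m, 0 < d & forall z, e <= z <= e + d -> g z = e + m * (z - e)].
Proof.
move=> ge; have [e0|e0] := ltP e 0.
  exists 1, (- e); split=> //; first by rewrite oppr_gt0.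
  by move=> z /andP[_ ze]; rewrite plo_le0 ?mul1r 1?addrC ?subrK // -(subrr e).
have [e1|e1] := leP 1 e.
  exists 1, 1; split=> // z /andP[ez _].
  by rewrite plo_ge1 ?mul1r 1?addrC ?subrK // (le_trans e1).
have [l brk] := plo_breaks (ploP g).
have [b [eb b1 _ nb]] := next_point l e1.
have [m [p aff]] := brk e b e0 eb b1 nb.
exists m, (b - e); split; [exact: affine_slope_gt0 aff|by rewrite subr_gt0|].
move=> z; rewrite addrC subrK => zI; rewrite aff // mulrBr.
have := aff e; rewrite lexx (ltW eb) ge => /(_ isT) E.
by lra.
Qed.

Lemma germ_left g e : g e = e -> exists m d : R,
  [/\ 0 < m, 0 < d & forall z, e - d <= z <= e -> g z = e + m * (z - e)].
Proof.
move=> ge; have [e1|e1] := ltP 1 e.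
  exists 1, (e - 1); split=> //; first by rewrite subr_gt0.
  move=> z /andP[ze _]; rewrite plo_ge1 ?mul1r 1?addrC ?subrK //.
  by rewrite (le_trans _ ze) // opprB addrC subrK.
have [e0|e0] := leP e 0.
  exists 1, 1; split=> // z /andP[_ ez].
  by rewrite plo_le0 ?mul1r 1?addrC ?subrK // (le_trans ez).
have [l brk] := plo_breaks (ploP g).
have [b [eb b1 _ nb]] := previous_point l e0.
have [m [p aff]] := brk b e b1 eb e1 nb.
exists m, (e - b); split; [exact: affine_slope_gt0 aff|by rewrite subr_gt0|].
move=> z; rewrite opprB addrC subrK => zI; rewrite aff // mulrBr.
have := aff e; rewrite lexx (ltW eb) ge => /(_ isT) E.
by lra.
Qed.

Lemma near_right g e : g e = e -> exists2 d : R, 0 < d &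
  [\/ forall z, e < z <= e + d -> z < g z,
      forall z, e < z <= e + d -> g z < z |
      forall z, e < z <= e + d -> g z = z].
Proof.
move=> /germ_right[m [d [m0 d0 gE]]]; exists d => //.
have [m1|m1|m1] := ltgtP m 1; [apply: Or32|apply: Or31|apply: Or33];
  move=> z /andP[ez zd]; rewrite gE ?(ltW ez) ?zd //; last by rewrite m1; ring.
  have : 0 < (1 - m) * (z - e) by rewrite mulr_gt0 ?subr_gt0.
  by lra.
have : 0 < (m - 1) * (z - e) by rewrite mulr_gt0 ?subr_gt0.
by lra.
Qed.

Lemma near_left g e : g e = e -> exists2 d : R, 0 < d &
  [\/ forall z, e - d <= z < e -> z < g z,
      forall z, e - d <= z < e -> g z < z |
      forall z, e - d <= z < e -> g z = z].
Proof.
move=> /germ_left[m [d [m0 d0 gE]]]; exists d => //.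
have [m1|m1|m1] := ltgtP m 1; [apply: Or31|apply: Or32|apply: Or33];
  move=> z /andP[dz ze]; rewrite gE ?(ltW ze) ?dz //; last by rewrite m1; ring.
  have : 0 < (1 - m) * (e - z) by rewrite mulr_gt0 ?subr_gt0.
  by lra.
have : 0 < (m - 1) * (e - z) by rewrite mulr_gt0 ?subr_gt0.
by lra.
Qed.

(** [g] is the identity on a neighbourhood of [e]. *)
Definition trivial_near g e :=
  exists2 d : R, 0 < d & forall z, e - d <= z <= e + d -> g z = z.

Lemma trivial_nearM g h e : trivial_near g e -> trivial_near h e ->
  trivial_near (g * h)%g e.
Proof.
move=> [d d0 gE] [d' d'0 hE]; exists (Num.min d d'); first by rewrite lt_min d0.
move=> z /andP[ez ze]; have [dd|dd] := leP d d'; rewrite ploM gE ?hE //; apply/andP;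
  split; move: ez ze; rewrite ?(min_l dd) ?(min_r (ltW dd)); lra.
Qed.

(** One-sided germs at a common fixed point are dilations, so they commute. *)
Lemma trivial_near_commutator g h e : g e = e -> h e = e ->
  trivial_near [~ g, h]%g e.
Proof.
move=> ge he.
have [m [d [m0 d0 gE]]] := germ_right ge; have [m' [d' [m'0 d'0 hE]]] := germ_right he.
have [n [c [n0 c0 gE']]] := germ_left ge; have [n' [c' [n'0 c'0 hE']]] := germ_left he.
have small r a b : 0 < r -> 0 < a -> 0 < b ->
    exists k : R, [/\ 0 < k, k <= a & r * k <= b].
  move=> r0 a0 b0; exists (Num.min a (b / r)).
  split; first by rewrite lt_min a0 divr_gt0.
    by rewrite ge_min lexx.
  by rewrite mulrC -ler_pdivlMr // ge_min lexx orbT.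
have [k1 [k10 k1d k1d']] := small _ _ _ m0 d0 d'0.
have [k2 [k20 k2d k2d']] := small _ _ _ m'0 d'0 d0.
have [k3 [k30 k3c k3c']] := small _ _ _ n0 c0 c'0.
have [k4 [k40 k4c k4c']] := small _ _ _ n'0 c'0 c0.
pose k := Num.min (Num.min k1 k2) (Num.min k3 k4).
have k0 : 0 < k by rewrite !lt_min k10 k20 k30 k40.
have kk1 : k <= k1 by rewrite !ge_min lexx.
have kk2 : k <= k2 by rewrite !ge_min lexx ?orbT.
have kk3 : k <= k3 by rewrite !ge_min lexx ?orbT.
have kk4 : k <= k4 by rewrite !ge_min lexx ?orbT.
clearbody k.
have com w : e - k <= w <= e + k -> h (g w) = g (h w).
  move=> /andP[kw wk]; have [ew|we] := leP e w.
    have w0 : 0 <= w - e by lra.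
    have h1 : m * (w - e) <= m * k1 by apply: ler_wpM2l; [exact: ltW|lra].
    have h2 : m' * (w - e) <= m' * k2 by apply: ler_wpM2l; [exact: ltW|lra].
    have h3 : 0 <= m * (w - e) by apply: mulr_ge0 => //; apply: ltW.
    have h4 : 0 <= m' * (w - e) by apply: mulr_ge0 => //; apply: ltW.
    rewrite (gE w) ?(hE w); [|lra..].
    by rewrite hE ?gE; [ring|lra..].
  have w0 : 0 <= e - w by lra.
  have h1 : n * (e - w) <= n * k3 by apply: ler_wpM2l; [exact: ltW|lra].
  have h2 : n' * (e - w) <= n' * k4 by apply: ler_wpM2l; [exact: ltW|lra].
  have h3 : 0 <= n * (e - w) by apply: mulr_ge0 => //; apply: ltW.
  have h4 : 0 <= n' * (e - w) by apply: mulr_ge0 => //; apply: ltW.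
  rewrite (gE' w) ?(hE' w); [|lra..].
  by rewrite hE' ?gE'; [ring|lra..].
have lo : h (g (e - k)) < e by rewrite -{2}he -{2}ge !plo_lt; lra.
have hi : e < h (g (e + k)) by rewrite -{1}he -{1}ge !plo_lt; lra.
exists (Num.min (e - h (g (e - k))) (h (g (e + k)) - e)).
  by rewrite lt_min !subr_gt0 lo.
move=> z /andP[z1 z2].
have [l1 l2] : h (g (e - k)) <= z /\ z <= h (g (e + k)).
  have m1 : Num.min (e - h (g (e - k))) (h (g (e + k)) - e) <= e - h (g (e - k)).
    by rewrite ge_min lexx.
  have m2 : Num.min (e - h (g (e - k))) (h (g (e + k)) - e) <= h (g (e + k)) - e.
    by rewrite ge_min lexx orbT.
  by split; lra.
rewrite commgEl conjgE !ploM com ?ploVK //.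
by rewrite !(plo_leV, plo_Vle) -!com ?l1 //; lra.
Qed.

(** ** Finiteness of the frontier of the fixed set *)

(** Apart from the breaks and the ends of the unit interval, an isolated fixed point
    lies between two consecutive breaks, where it is unique. *)
Lemma frontier_fixed_finite x : exists D : seq R,
  (forall d, d \in D -> x d = d) /\
  (forall e, x e = e -> e \notin D -> trivial_near x e).
Proof.
have [l brk] := plo_breaks (ploP x).
pose L := 0 :: 1 :: l.
pose F p q := xget 0 [set e | p < e < q /\ x e = e].
pose D := [seq d <- L ++ [seq F p q | p <- L, q <- L] | x d == d].
exists D; split=> [d|e xe eD]; first by rewrite mem_filter => /andP[/eqP].
have eD' : e \notin L ++ [seq F p q | p <- L, q <- L].
  by move: eD; rewrite mem_filter xe eqxx.
have [e0|e0|e0] := ltgtP e 0; last 1 first.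
- by move: eD'; rewrite mem_cat !inE e0 eqxx.
- exists (- e); first by rewrite oppr_gt0.
  by move=> z /andP[_ ze]; apply: plo_le0; lra.
have [e1|e1|e1] := ltgtP e 1; last 1 first.
- by move: eD'; rewrite mem_cat !inE e1 eqxx orbT.
- have [a [ae a0 aL na]] := previous_point l e0.
  have [b [eb b1 bL nb]] := next_point l e1.
  have [m [p aff]] : exists m p, forall z, a <= z <= b -> x z = m * z + p.
    apply: brk => //; first exact: lt_trans ae eb.
    move=> c cl /andP[ac cb]; have [ec|ce|ec] := ltgtP e c.
    + by apply: (nb c cl); rewrite ec.
    + by apply: (na c cl); rewrite ac.
    + by move: eD'; rewrite mem_cat ec /L !inE cl !orbT.
  have xE := aff e; rewrite (ltW ae) (ltW eb) xe in xE; have {}xE := xE isT.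
  have [m1|m1] := eqVneq m 1.
    exists (Num.min (e - a) (b - e)); first by rewrite lt_min !subr_gt0 ae.
    move=> z /andP[z1 z2]; rewrite aff ?m1; first by rewrite m1 in xE; lra.
    have k1 : Num.min (e - a) (b - e) <= e - a by rewrite ge_min lexx.
    have k2 : Num.min (e - a) (b - e) <= b - e by rewrite ge_min lexx orbT.
    by apply/andP; split; lra.
  have Fe : F a b = e.
    apply: xget_unique; first by rewrite /= ae eb.
    move=> e' [/andP[ae' eb'] xe']; have := aff e'; rewrite xe' (ltW ae') (ltW eb').
    move=> /(_ isT) xE'; have m1' : 1 - m != 0 by rewrite subr_eq0 eq_sym.
    by apply: (mulfI m1'); lra.
  move: eD'; rewrite mem_cat negb_or => /andP[_ /negP[]].
  apply/allpairsP; exists (a, b); split=> //=.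
  + by move: aL; rewrite !inE => /orP[->//|->]; rewrite !orbT.
  + by move: bL; rewrite !inE => /orP[->//|->]; rewrite !orbT.
- exists (e - 1); first by rewrite subr_gt0.
  by move=> z /andP[ze _]; apply: plo_ge1; lra.
Qed.

End PLoBasics.

(** * Gaps of the fixed set *)

Section Gaps.
Variable R : realType.
Local Open Scope ring_scope.
Implicit Types (g h x y : PLo R) (a b c e s t z w : R) (n : nat) (S : set (PLo R)).

(** [e] is fixed by all elements of [S]. *)
Definition fixed S e := forall g, S g -> g e = e.

(** [(s, t)] is a component of the complement of the common fixed set of [S]. *)
Definition gap S s t :=
  [/\ s < t, fixed S s, fixed S t & forall z, s < z < t -> ~ fixed S z].

Lemma fixed1 x e : x e = e <-> fixed [set x] e.
Proof. by split=> [E _ -> //|]; apply. Qed.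

Lemma fixed2 x y e : fixed [set x; y] e <-> x e = e /\ y e = e.
Proof. by split=> [F|[xe ye] _ [->|->] //]; split; apply: F; [left|right]. Qed.

Lemma fixed_generated S e g : fixed S e -> generated S g -> g e = e.
Proof.
move=> F; refine (@generated_ind _ _ (fun g => g e = e) _ _ _ _ g) => //.
- by move=> a b ae be; rewrite ploM ae.
- by move=> a; apply: plo_fixV.
Qed.

Lemma gap_interval S s t g z : gap S s t -> generated S g ->
  s < z < t -> s < g z < t.
Proof.
move=> [_ fs ft _] gg /andP[sz zt].
by rewrite -{1}(fixed_generated fs gg) -{1}(fixed_generated ft gg) !plo_lt sz.
Qed.

Lemma gap_unique S s t s' t' z : gap S s t -> gap S s' t' ->
  s < z < t -> s' < z < t' -> s = s' /\ t = t'.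
Proof.
move=> [_ fs ft no] [_ fs' ft' no'] /andP[sz zt] /andP[s'z zt'].
split; apply/eqP; rewrite eq_le !leNgt; apply/andP; split; apply/negP => lt.
- by apply: (no' s) => //; rewrite lt (lt_trans sz).
- by apply: (no s') => //; rewrite lt (lt_trans s'z).
- by apply: (no t') => //; rewrite lt (lt_trans sz).
- by apply: (no' t) => //; rewrite lt (lt_trans s'z).
Qed.

Lemma sup_invariant (E : set R) g : has_sup E ->
  (forall w, E w -> E (g w)) -> (forall w, E w -> E ((g^-1)%g w)) -> g (sup E) = sup E.
Proof.
move=> supE Eg EV; have [_ ubE] := supE.
have [lt|gt|//] := ltgtP (g (sup E)) (sup E).
  have [w Ew] := sup_adherent (eps := sup E - g (sup E)) ltac:(by rewrite subr_gt0) supE.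
  rewrite opprB addrC subrK -plo_Vlt => /lt_geF/negP[].
  by apply: ub_le_sup => //; apply: EV.
have lt : (g^-1)%g (sup E) < sup E by rewrite plo_ltV.
have [w Ew] := sup_adherent (eps := sup E - (g^-1)%g (sup E))
  ltac:(by rewrite subr_gt0) supE.
rewrite opprB addrC subrK plo_ltV => /lt_geF/negP[].
by apply: ub_le_sup => //; apply: Eg.
Qed.

Lemma inf_invariant (E : set R) g : has_inf E ->
  (forall w, E w -> E (g w)) -> (forall w, E w -> E ((g^-1)%g w)) -> g (inf E) = inf E.
Proof.
move=> infE Eg EV; have [_ lbE] := infE.
have [lt|gt|//] := ltgtP (g (inf E)) (inf E).
  have gt : inf E < (g^-1)%g (inf E) by rewrite plo_Vlt.
  have [w Ew] := inf_adherent (eps := (g^-1)%g (inf E) - inf E)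
    ltac:(by rewrite subr_gt0) infE.
  rewrite addrC subrK plo_Vlt => /lt_geF/negP[].
  by apply: ge_inf => //; apply: Eg.
have [w Ew] := inf_adherent (eps := g (inf E) - inf E) ltac:(by rewrite subr_gt0) infE.
rewrite addrC subrK -plo_ltV => /lt_geF/negP[].
by apply: ge_inf => //; apply: EV.
Qed.

Lemma gap_exists S z : ~ fixed S z -> exists s t, gap S s t /\ s < z < t.
Proof.
move=> nz; have z0 : 0 < z.
  by rewrite ltNge; apply/negP => z0; apply: nz => g _; apply: plo_le0.
have z1 : z < 1.
  by rewrite ltNge; apply/negP => z1; apply: nz => g _; apply: plo_ge1.
pose E := [set e | e <= z /\ fixed S e]; pose F := [set e | z <= e /\ fixed S e].
have supE : has_sup E.
  split; last by exists z => e [].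
  by exists 0; split; [apply: ltW | move=> g _; apply: plo_end0].
have infF : has_inf F.
  split; last by exists z => e [].
  by exists 1; split; [apply: ltW | move=> g _; apply: plo_end1].
have fs : fixed S (sup E).
  move=> g Sg; apply: sup_invariant => // w [wz fw].
    by rewrite fw.
  by rewrite plo_fixV // fw.
have ft : fixed S (inf F).
  move=> g Sg; apply: inf_invariant => // w [wz fw].
    by rewrite fw.
  by rewrite plo_fixV // fw.
have sz : sup E < z.
  rewrite lt_neqAle ge_sup ?andbT; first by apply/eqP => E0; apply: nz; rewrite -E0.
    by case: supE.
  by move=> e [].
have zt : z < inf F.
  rewrite lt_neqAle lb_le_inf ?andbT; first by apply/eqP => E0; apply: nz; rewrite E0.
    by case: infF.
  by move=> e [].
exists (sup E), (inf F); split; last by rewrite sz.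
split=> //; first exact: lt_trans sz zt.
move=> w /andP[sw wt] fw; have [wz|zw] := leP w z.
  by move: sw; rewrite ltNge => /negP[]; apply: ub_le_sup; [case: supE|].
by move: wt; rewrite ltNge => /negP[]; apply: ge_inf; [case: infF|split=> //; apply: ltW].
Qed.

(** Orbits are unbounded in a gap: the supremum of a bounded one would be a common
    fixed point. *)
Lemma gap_displace S s t a b : gap S s t -> s < a -> b < t ->
  exists2 g, generated S g & b < g a.
Proof.
move=> G sa bt; have [//|nex] := pselect (exists2 g, generated S g & b < g a).
have [ba|ab] := ltP b a.
  by exists 1%g => //; apply: (subgroup1 (generated_subgroup S)).
have le g : generated S g -> g a <= b.
  by move=> gg; rewrite leNgt; apply/negP => lt; apply: nex; exists g.
pose E := [set g a | g in generated S].
have sG := generated_subgroup S.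
have supE : has_sup E.
  split; last by exists b => _ [g gg <-]; apply: le.
  by exists a; exists 1%g => //; apply: (subgroup1 sG).
have aE : a <= sup E.
  by apply: ub_le_sup; [case: supE|exists 1%g => //; apply: (subgroup1 sG)].
have Eb : sup E <= b.
  by apply: ge_sup; [case: supE|move=> _ [g gg <-]; apply: le].
case: G => _ _ _ /(_ (sup E)) []; first by rewrite (lt_le_trans sa) // (le_lt_trans Eb).
move=> g Sg; have gg : generated S g by apply: sub_generated.
apply: sup_invariant => // _ [h gh <-].
  by exists (h * g)%g => //; apply: (subgroupM sG).
by exists (h * g^-1)%g => //; apply: (subgroupM sG) => //; apply: (subgroupV sG).
Qed.

Lemma powers_nondecreasing x n m a : a <= x a -> (n <= m)%N -> (x ^+ n)%g a <= (x ^+ m)%g a.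
Proof.
move=> ax /subnK <-; elim: (m - n)%N => [|k IHk] //.
by apply: le_trans IHk _; rewrite addSn expgS ploM plo_le.
Qed.

Lemma powers_nonincreasing x n m a : x a <= a -> (n <= m)%N -> (x ^+ m)%g a <= (x ^+ n)%g a.
Proof.
move=> ax /subnK <-; elim: (m - n)%N => [|k IHk] //.
by apply: le_trans IHk; rewrite addSn expgS ploM plo_le.
Qed.

(** The set of points that are at most some [(x ^+ n) a] is invariant under [x] and its
    inverse; if it were bounded, its supremum would be fixed by [x]. *)
Lemma escape x a b : a < x a -> (forall z, a <= z <= b -> z < x z) ->
  exists N, forall n, (N <= n)%N -> b < (x ^+ n)%g a.
Proof.
move=> ax mv; have [[N bN]|nex] := pselect (exists N, b < (x ^+ N)%g a).
  by exists N => n Nn; apply: lt_le_trans bN _; apply: powers_nondecreasing => //; apply: ltW.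
have le n : (x ^+ n)%g a <= b by rewrite leNgt; apply/negP => lt; apply: nex; exists n.
pose E := [set w | exists n, w <= (x ^+ n)%g a].
have supE : has_sup E.
  split; last by exists b => w [n] /le_trans; apply.
  by exists a; exists 0%N.
have aE : a <= sup E by apply: ub_le_sup; [case: supE|exists 0%N].
have Eb : sup E <= b by apply: ge_sup; [case: supE|move=> w [n] /le_trans; apply].
have := mv (sup E); rewrite aE Eb => /(_ isT).
rewrite sup_invariant ?ltxx // => w [n wn]; exists n.+1.
  by rewrite ploXS plo_le.
rewrite plo_leV -ploXS; apply: le_trans wn _.
by apply: powers_nondecreasing => //; [apply: ltW|lia].
Qed.

Lemma move_right_propagate x a b : a <= b -> (forall z, a <= z <= b -> x z <> z) ->
  a < x a -> b < x b.
Proof.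
move=> ab mv ax; pose E := [set w | a <= w <= b /\ w < x w].
have supE : has_sup E.
  split; last by exists b => w [/andP[]].
  by exists a; split=> //; rewrite lexx.
have aE : a <= sup E by apply: ub_le_sup; [case: supE|split; rewrite ?lexx].
have Eb : sup E <= b by apply: ge_sup; [case: supE|move=> w [/andP[]]].
have [lt|gt|/esym E0] := ltgtP (sup E) (x (sup E)); last first.
- by case: (mv (sup E)); rewrite ?aE.
- have [w [/andP[aw wb] xw]] :=
    sup_adherent (eps := sup E - x (sup E)) ltac:(by rewrite subr_gt0) supE.
  rewrite opprB addrC subrK => lt.
  have : w <= sup E by apply: ub_le_sup; [case: supE|split=> //; rewrite aw].
  by rewrite -(plo_le x) leNgt (lt_trans lt).
- have [bE|Eb'] := leP b (sup E).
    by have -> : b = sup E by apply/eqP; rewrite eq_le bE.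
  pose w := (sup E + Num.min b (x (sup E))) / 2.
  have [m1 m2 m3] : [/\ Num.min b (x (sup E)) <= b,
      Num.min b (x (sup E)) <= x (sup E) & sup E < Num.min b (x (sup E))].
    by rewrite !ge_min !lexx orbT lt_min Eb' lt.
  have wE : sup E < w by rewrite /w; lra.
  have : w <= sup E.
    apply: ub_le_sup; [by case: supE|split; first by rewrite /w; apply/andP; split; lra].
    apply: lt_trans (_ : x (sup E) < _); first by rewrite /w; lra.
    by rewrite plo_lt.
  by rewrite leNgt wE.
Qed.

Lemma move_left_propagate x a b : a <= b -> (forall z, a <= z <= b -> x z <> z) ->
  x a < a -> x b < b.
Proof.
move=> ab mv ax; rewrite -plo_Vlt; apply: (move_right_propagate ab).
  by move=> z zI E; apply: (mv z zI); rewrite -{1}E ploVK.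
by rewrite plo_Vlt.
Qed.

Lemma gap_direction x s t : gap [set x] s t ->
  (forall z, s < z < t -> z < x z) \/ (forall z, s < z < t -> x z < z).
Proof.
move=> [st _ _ no]; have no' z : s < z < t -> x z <> z.
  by move=> /no nz E; apply: nz; apply/fixed1.
have [m smt] : exists m, s < m < t by exists ((s + t) / 2); rewrite !midf_lt.
have mv a b : s < a < t -> s < b < t -> forall z, a <= z <= b -> x z <> z.
  move=> /andP[sa _] /andP[_ bt] z /andP[az zb]; apply: no'.
  by rewrite (lt_le_trans sa az) (le_lt_trans zb bt).
have [lt|gt|/esym E] := ltgtP m (x m); last by case: (no' _ smt).
  left=> z zI; have [mz|/ltW zm] := leP m z.
    exact: move_right_propagate mz (mv _ _ smt zI) lt.
  have [//|lt'|/esym E] := ltgtP z (x z); last by case: (no' _ zI).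
  by have := move_left_propagate zm (mv _ _ zI smt) lt'; rewrite ltNge (ltW lt).
right=> z zI; have [mz|/ltW zm] := leP m z.
  exact: move_left_propagate mz (mv _ _ smt zI) gt.
have [lt'|//|/esym E] := ltgtP z (x z); last by case: (no' _ zI).
by have := move_right_propagate zm (mv _ _ zI smt) lt'; rewrite ltNge (ltW gt).
Qed.

(** If [x] moves all points of an interval following its fixed point [s], then one of
    its gaps starts at [s]. *)
Lemma gap_from_left x s d t : x s = s -> 0 < d ->
  (forall z, s < z <= s + d -> x z <> z) -> s + d < t -> x t = t ->
  exists2 f, f <= t & gap [set x] s f.
Proof.
move=> xs d0 mv sdt xt.
have : ~ fixed [set x] (s + d) by move/fixed1; apply: mv; rewrite ltrDl d0 lexx.
move=> /gap_exists[s0 [t0 [G /andP[sd dt]]]].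
have [lt0 fs0 ft0 no] := G.
have es : s0 = s.
  apply/eqP; rewrite eq_le !leNgt; apply/andP; split; apply/negP => lt.
    by apply: (mv s0); [rewrite lt (ltW sd)|apply/fixed1].
  by apply: (no s); [rewrite lt (lt_trans _ dt) // ltrDl|apply/fixed1].
exists t0; last by rewrite -es.
by rewrite leNgt; apply/negP => lt; apply: (no t); [rewrite lt (lt_trans sd)|apply/fixed1].
Qed.

Lemma gap_from_right x s d t : x t = t -> 0 < d ->
  (forall z, t - d <= z < t -> x z <> z) -> s < t - d -> x s = s ->
  exists2 f, s <= f & gap [set x] f t.
Proof.
move=> xt d0 mv sdt xs.
have lt1 : t - d < t by rewrite ltrBlDr ltrDl.
have : ~ fixed [set x] (t - d) by move/fixed1; apply: mv; rewrite lt1 lexx.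
move=> /gap_exists[s0 [t0 [G /andP[sd dt]]]].
have [lt0 fs0 ft0 no] := G.
have es : t0 = t.
  apply/eqP; rewrite eq_le !leNgt; apply/andP; split; apply/negP => lt.
    by apply: (no t); [rewrite lt (lt_trans sd)|apply/fixed1].
  by apply: (mv t0); [rewrite lt (ltW dt)|apply/fixed1].
exists s0; last by rewrite -es.
by rewrite leNgt; apply/negP => lt; apply: (no s); [rewrite lt (lt_trans sdt)|apply/fixed1].
Qed.

End Gaps.

(** * Repelling configurations *)

Section Repelling.
Variable R : realType.
Local Open Scope ring_scope.
Implicit Types (g h k x y : PLo R) (a b c d e s t z w p q : R) (n : nat) (S : set (PLo R)).

Lemma small_pos a b : 0 < a -> 0 < b -> exists r : R, [/\ 0 < r, r <= a & r < b].
Proof.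
move=> a0 b0; exists (Num.min a (b / 2)).
rewrite lt_min a0 ge_min lexx gt_min; split; [lra|by []|].
by apply/orP; right; lra.
Qed.

(** The behaviour of [x] on a one-sided neighbourhood of a point: [x] moves the points
    right after [s] to the right or to the left, or fixes them; similarly for the
    points right before [t]. *)
Definition right_after x s := exists2 d : R, 0 < d & forall z, s < z <= s + d -> z < x z.
Definition left_after x s := exists2 d : R, 0 < d & forall z, s < z <= s + d -> x z < z.
Definition fix_after x s := exists2 d : R, 0 < d & forall z, s < z <= s + d -> x z = z.
Definition right_before x t := exists2 d : R, 0 < d & forall z, t - d <= z < t -> z < x z.
Definition left_before x t := exists2 d : R, 0 < d & forall z, t - d <= z < t -> x z < z.
Definition fix_before x t := exists2 d : R, 0 < d & forall z, t - d <= z < t -> x z = z.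

Lemma after_cases x s : x s = s -> [\/ right_after x s, left_after x s | fix_after x s].
Proof.
by case/near_right=> d d0 [] ?; [apply: Or31|apply: Or32|apply: Or33]; exists d.
Qed.

Lemma before_cases x t : x t = t -> [\/ right_before x t, left_before x t | fix_before x t].
Proof.
by case/near_left=> d d0 [] ?; [apply: Or31|apply: Or32|apply: Or33]; exists d.
Qed.

Lemma right_afterV x s : right_after x s -> left_after (x^-1)%g s.
Proof. by case=> d d0 mv; exists d => // z /mv; rewrite plo_ltV. Qed.
Lemma left_afterV x s : left_after x s -> right_after (x^-1)%g s.
Proof. by case=> d d0 mv; exists d => // z /mv; rewrite plo_Vlt. Qed.
Lemma left_beforeV x t : left_before x t -> right_before (x^-1)%g t.
Proof. by case=> d d0 mv; exists d => // z /mv; rewrite plo_Vlt. Qed.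

Lemma left_afterM x y s : x s = s -> left_after x s -> fix_after y s ->
  left_after (x * y)%g s.
Proof.
move=> xs [d d0 mv] [d' d'0 fx]; exists (Num.min d d'); first by rewrite lt_min d0.
have [l1 l2] : Num.min d d' <= d /\ Num.min d d' <= d' by rewrite !ge_min !lexx orbT.
move=> z /andP[sz zd]; have xz := mv z; rewrite sz (le_trans zd) ?lerD2l // in xz.
rewrite ploM fx ?xz // -{1}xs plo_lt sz /=.
by rewrite (le_trans (ltW (xz isT))) // (le_trans zd) ?lerD2l.
Qed.

Lemma right_beforeM x y t : fix_before x t -> right_before y t ->
  right_before (x * y)%g t.
Proof.
move=> [d d0 fx] [d' d'0 mv]; exists (Num.min d d'); first by rewrite lt_min d0.
have [l1 l2] : Num.min d d' <= d /\ Num.min d d' <= d' by rewrite !ge_min !lexx orbT.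
move=> z /andP[dz zt]; rewrite ploM fx ?mv // zt andbT; apply: le_trans dz;
  by rewrite lerD2l lerN2.
Qed.

(** [x] fixes [s < f1 <= fm < t] and expands [[f1, fm]]: it moves the points of
    [(s, f1)] to the left and those of [(fm, t)] to the right. *)
Definition repelling x s t f1 fm :=
  [/\ [/\ s < f1, f1 <= fm & fm < t],
      [/\ x s = s, x t = t, x f1 = f1 & x fm = fm],
      forall z, s < z < f1 -> x z < z &
      forall z, fm < z < t -> z < x z].

(** [f1] and [fm] are the first and the last fixed point of [x] in [(s, t)]. *)
Lemma repelling_exists x s t : s < t -> x s = s -> x t = t ->
  left_after x s -> right_before x t -> exists f1 fm, repelling x s t f1 fm.
Proof.
move=> st xs xt [d d0 mvl] [d' d'0 mvr].
have [r1 [r10 r1d r1d']] := small_pos d0 d'0.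
have [r [r0 rr1 rst]] : exists r, [/\ 0 < r, r <= r1 & r < (t - s) / 2].
  by apply: small_pos => //; lra.
have rd : r <= d by lra.
have rd' : r <= d' by lra.
have mvl' z : s < z <= s + r -> x z < z.
  by move=> /andP[sz zr]; apply: mvl; rewrite sz (le_trans zr) ?lerD2l.
have mvr' z : t - r <= z < t -> z < x z.
  by move=> /andP[rz zt]; apply: mvr; rewrite zt andbT (le_trans _ rz) // lerD2l lerN2.
have rt : s + r < t - r by lra.
have [f1 f1t G1] : exists2 f, f <= t & gap [set x] s f.
  apply: (@gap_from_left _ x s r) => //; last by lra.
  by move=> z /mvl' lt E; rewrite E ltxx in lt.
have [fm sfm Gm] : exists2 f, s <= f & gap [set x] f t.
  apply: (@gap_from_right _ x s r) => //; last by lra.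
  by move=> z /mvr' lt E; rewrite E ltxx in lt.
have [sf1 _ /fixed1 xf1 no1] := G1; have [fmt /fixed1 xfm _ nom] := Gm.
have L z : s < z < f1 -> x z < z.
  have [Rt|h] := gap_direction G1; last exact: h.
  have [w [sw wf wr]] : exists w, [/\ s < w, w < f1 & w <= s + r].
    have [r2 [r20 r2r r2f]] : exists r2, [/\ 0 < r2, r2 <= r & r2 < f1 - s].
      by apply: small_pos => //; lra.
    by exists (s + r2); split; lra.
  have := Rt w; rewrite sw wf => /(_ isT); have := mvl' w; rewrite sw wr => /(_ isT).
  by move=> l1 l2; have := lt_trans l1 l2; rewrite ltxx.
have Rt z : fm < z < t -> z < x z.
  have [h|Lt] := gap_direction Gm; first exact: h.
  have [w [sw wf wr]] : exists w, [/\ fm < w, w < t & t - r <= w].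
    have [r2 [r20 r2r r2f]] : exists r2, [/\ 0 < r2, r2 <= r & r2 < t - fm].
      by apply: small_pos => //; lra.
    by exists (t - r2); split; lra.
  have := Lt w; rewrite sw wf => /(_ isT); have := mvr' w; rewrite wr wf => /(_ isT).
  by move=> l1 l2; have := lt_trans l1 l2; rewrite ltxx.
have lef : f1 <= fm.
  rewrite leNgt; apply/negP => lt.
  have [sfm'|fms] := ltP s fm; first by apply: (no1 fm); [rewrite sfm'|apply/fixed1].
  have efm : fm = s by apply/eqP; rewrite eq_le fms.
  have l1 : x (s + r) < s + r by apply: mvl'; lra.
  have l2 : s + r < x (s + r) by apply: Rt; lra.
  by have := lt_trans l1 l2; rewrite ltxx.
exists f1, fm; split=> //; split=> //.
Qed.

(** In addition, [y] fixes [s] and [t] and moves [[f1, fm]] to the right, off itself. *)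
Definition expander x y s t f1 fm :=
  repelling x s t f1 fm /\ [/\ y s = s, y t = t & fm < y f1].

(** Some two elements of [H] form an expander. *)
Definition has_expander (H : set (PLo R)) :=
  exists x y s t f1 fm, [/\ H x, H y & expander x y s t f1 fm].

Lemma gap_expander S s t x : gap S s t -> generated S x -> left_after x s ->
  right_before x t -> has_expander (generated S).
Proof.
move=> G gx La Rb; have [st fs ft _] := G.
have [f1 [fm rep]] := repelling_exists st (fixed_generated fs gx)
  (fixed_generated ft gx) La Rb.
have [[sf1 _ fmt] _ _ _] := rep.
have [y gy yf] := gap_displace G sf1 fmt.
exists x, y, s, t, f1, fm; split=> //; split=> //.
by rewrite (fixed_generated fs gy) (fixed_generated ft gy).
Qed.

(** Here [f1] and [fm] are the extreme fixed points of [k] in the gap, and [l] is the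
    commutator of a large power of [k] with the inverse of an element [g1] that moves
    [f1] beyond [fm]: the power pushes [g1 f1] beyond [g1 fm]. *)
Lemma displaced_fixed_points S s t k p : gap S s t -> generated S k ->
  right_after k s -> right_before k t -> k p = p -> s < p < t ->
  exists f1 fm l, [/\ [/\ s < f1, f1 <= fm & fm < t], k f1 = f1,
    forall z, s < z < f1 -> z < k z, forall z, fm < z < t -> z < k z &
    [/\ generated S l, trivial_near l s, trivial_near l t & fm < l f1]].
Proof.
move=> G gk [ds ds0 Rs] [dt dt0 Rt] kp /andP[sp pt].
have [st fs ft no] := G; have sG := generated_subgroup S.
have ks := fixed_generated fs gk; have kt := fixed_generated ft gk.
have [f1 f1p G1] : exists2 f, f <= p & gap [set k] s f.
  have [r [r0 rd rp]] : exists r, [/\ 0 < r, r <= ds & r < p - s].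
    by apply: small_pos => //; lra.
  apply: (@gap_from_left _ k s r) => //; last by lra.
  move=> z zI E; have : z < k z by apply: Rs; lra.
  by rewrite E ltxx.
have [fm pfm Gm] : exists2 f, p <= f & gap [set k] f t.
  have [r [r0 rd rp]] : exists r, [/\ 0 < r, r <= dt & r < t - p].
    by apply: small_pos => //; lra.
  apply: (@gap_from_right _ k p r) => //; last by lra.
  move=> z zI E; have : z < k z by apply: Rt; lra.
  by rewrite E ltxx.
have [sf1 _ /fixed1 kf1 no1] := G1; have [fmt /fixed1 kfm _ nom] := Gm.
have f1fm : f1 <= fm := le_trans f1p pfm.
have R1 z : s < z < f1 -> z < k z.
  have [h|Lt] := gap_direction G1; first exact: h.
  have [r [r0 rd rf]] : exists r, [/\ 0 < r, r <= ds & r < f1 - s].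
    by apply: small_pos => //; lra.
  have l1 : k (s + r) < s + r by apply: Lt; lra.
  have l2 : s + r < k (s + r) by apply: Rs; lra.
  by have := lt_trans l1 l2; rewrite ltxx.
have Rm z : fm < z < t -> z < k z.
  have [h|Lt] := gap_direction Gm; first exact: h.
  have [r [r0 rd rf]] : exists r, [/\ 0 < r, r <= dt & r < t - fm].
    by apply: small_pos => //; lra.
  have l1 : k (t - r) < t - r by apply: Lt; lra.
  have l2 : t - r < k (t - r) by apply: Rt; lra.
  by have := lt_trans l1 l2; rewrite ltxx.
have [g1 gg1 g1f] := gap_displace G sf1 fmt.
have g1lt z : z < t -> g1 z < t by rewrite -{2}(fixed_generated ft gg1) plo_lt.
have [N NP] : exists N, forall n, (N <= n)%N -> g1 fm < (k ^+ n)%g (g1 f1).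
  apply: escape; first by apply: Rm; rewrite g1f g1lt // (le_lt_trans f1fm).
  move=> z /andP[z1 z2]; apply: Rm; rewrite (lt_le_trans g1f) //.
  exact: le_lt_trans z2 (g1lt _ fmt).
have gkX n : generated S (k ^+ n)%g by apply: (subgroupX _ sG).
pose l := [~ k ^+ N, g1^-1]%g.
have gl : generated S l.
  by apply: (subgroupM sG); [apply: (subgroupV sG)|apply: (subgroupJ sG) => //;
     apply: (subgroupV sG)].
have lf1 : fm < l f1.
  rewrite /l commgEl conjgE invgK !ploM plo_Vlt.
  by rewrite (plo_fixV (plo_fixX _ kf1)); apply: NP.
have ls : trivial_near l s.
  apply: trivial_near_commutator; first exact: plo_fixX.
  exact/plo_fixV/(fixed_generated fs).
have lt_triv : trivial_near l t.
  apply: trivial_near_commutator; first exact: plo_fixX.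
  exact/plo_fixV/(fixed_generated ft).
by exists f1, fm, l; split.
Qed.

(** Let [(j1, j2)] be the gap of [l] around the fixed points of [k], and let [m] be the
    conjugate of [l] by a large power [K] of [k]. Near [j1] the element [m] is the
    identity, because [K] moves the support of [l] in [(s, f1)] beyond [j1]; near [K j2] it is [l] that is the identity. So [l^-1 * m] repels the fixed
    points it has in [(j1, K j2)], which is a gap of [l] and [m]. *)
Lemma same_direction_expander S s t k p : gap S s t -> generated S k ->
  right_after k s -> right_before k t -> k p = p -> s < p < t ->
  has_expander (generated S).
Proof.
move=> G gk Rs Rt kp pI; have [st fs ft no] := G; have sG := generated_subgroup S.
have ks := fixed_generated fs gk; have kt := fixed_generated ft gk.
have [f1 [fm [l [[sf1 f1fm fmt] kf1 R1 Rm [gl [es es0 ls] [et et0 lt_triv] lf1]]]]] :=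
  displaced_fixed_points G gk Rs Rt kp pI.
have gkX n : generated S (k ^+ n)%g by apply: (subgroupX _ sG).
clear Rs Rt kp pI G.
have : ~ fixed [set l] f1.
  by move=> /fixed1 E; move: lf1; rewrite E ltNge f1fm.
move=> /gap_exists[j1 [j2 [J /andP[jf1 fj2]]]].
have [j12 /fixed1 lj1 /fixed1 lj2 noJ] := J.
have [s1 [s1s s1f ls1]] : exists s1, [/\ s < s1, s1 < f1 &
    forall z, s <= z <= s1 -> l z = z].
  have [r [r0 rd rf]] : exists r, [/\ 0 < r, r <= es & r < f1 - s].
    by apply: small_pos => //; lra.
  by exists (s + r); split; [lra|lra|move=> z zI; apply: ls; lra].
have [b [bt fmb lb]] : exists b, [/\ b < t, fm < b &
    forall z, b <= z <= t -> l z = z].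
  have [r [r0 rd rf]] : exists r, [/\ 0 < r, r <= et & r < t - fm].
    by apply: small_pos => //; lra.
  by exists (t - r); split; [lra|lra|move=> z zI; apply: lt_triv; lra].
have s1j : s1 <= j1.
  rewrite leNgt; apply/negP => lt; apply: (noJ s1); first by rewrite lt (lt_trans s1f).
  by apply/fixed1/ls1; rewrite lexx ltW.
have j2b : j2 <= b.
  rewrite leNgt; apply/negP => lt; apply: (noJ b).
    by rewrite lt (lt_trans jf1) // (le_lt_trans f1fm).
  by apply/fixed1/lb; rewrite lexx ltW.
have fmj2 : fm < j2 by apply: lt_trans lf1 _; rewrite -[ltRHS]lj2 plo_lt.
have lR z : j1 < z < j2 -> z < l z.
  have [h|Lt] := gap_direction J; first exact: h.
  have := Lt f1; rewrite jf1 fj2 => /(_ isT).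
  by move=> /(lt_trans lf1); rewrite ltNge f1fm.
have [N1 N1P] : exists N, forall n, (N <= n)%N -> j1 < (k ^+ n)%g s1.
  apply: escape; first by apply: R1; rewrite s1s.
  by move=> z /andP[z1 z2]; apply: R1; rewrite (lt_le_trans s1s) // (le_lt_trans z2).
have [N2 N2P] : exists N, forall n, (N <= n)%N -> b < (k ^+ n)%g j2.
  apply: escape; first by apply: Rm; rewrite fmj2 (le_lt_trans j2b).
  by move=> z /andP[z1 z2]; apply: Rm; rewrite (lt_le_trans fmj2) // (le_lt_trans z2).
pose K := (k ^+ maxn N1 N2)%g.
have Ks1 : j1 < K s1 by apply: N1P; apply: leq_maxl.
have Kj2 : b < K j2 by apply: N2P; apply: leq_maxr.
have gK : generated S K by apply: gkX.
have Ks : K s = s by apply: plo_fixX.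
have Kt : K t = t by apply: plo_fixX.
have Kf1 : K f1 = f1 by apply: plo_fixX.
clearbody K.
pose m := (l ^ K)%g.
have mE z : m z = K (l ((K^-1)%g z)) by rewrite /m conjgE !ploM.
have gm : generated S m by apply: (subgroupJ sG).
have ml z : s <= z <= K s1 -> m z = z.
  move=> /andP[sz zK]; rewrite mE ls1 ?ploVK //.
  by rewrite plo_Vle Ks sz plo_leV.
have mK : m (K j2) = K j2 by rewrite mE ploK lj2.
have Kj2t : K j2 < t by rewrite -Kt plo_lt (le_lt_trans j2b).
have sj1 : s < j1 := lt_le_trans s1s s1j.
have j1K : j1 < K j2 by rewrite (lt_trans jf1) // -Kf1 plo_lt.
have mj1 : m j1 = j1 by rewrite ml // !ltW.
have G' : gap [set l; m] j1 (K j2).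
  split=> //; first exact/fixed2.
    by apply/fixed2; split=> //; apply: lb; rewrite !ltW.
  move=> z /andP[jz zK] /fixed2[lz mz]; have [zj|jz'] := ltP z j2.
    by have := lR z; rewrite jz zj lz ltxx => /(_ isT).
  have := lR ((K^-1)%g z); rewrite plo_ltV zK andbT plo_Vlt.
  have Kj1 : K j1 < f1 by rewrite -{1}Kf1 plo_lt.
  rewrite (lt_le_trans (lt_trans Kj1 fj2) jz').
  by move=> /(_ isT); rewrite -(plo_lt K) -mE ploVK mz ltxx.
have gxy g : generated [set l; m] g -> generated S g.
  by apply: generated_sub => // _ [->|->].
have [x [y [s' [t' [u1 [um [gx gy E]]]]]]] : has_expander (generated [set l; m]).
  apply: (@gap_expander _ j1 (K j2) (l^-1 * m)%g) => //.
  - have sG' := generated_subgroup [set l; m].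
    by apply: (subgroupM sG'); [apply: (subgroupV sG')|];
       apply: sub_generated; [left|right].
  - have [r [r0 rK rj]] : exists r, [/\ 0 < r, r <= K s1 - j1 & r < j2 - j1].
      by apply: small_pos; lra.
    exists r => //.
    move=> z /andP[jz zd]; rewrite ploM.
    have lz : (l^-1)%g z < z by rewrite plo_ltV lR // jz; lra.
    have jl : j1 < (l^-1)%g z by rewrite plo_Vlt lj1.
    rewrite ml //; apply/andP; split; first exact: le_trans (ltW sj1) (ltW jl).
    by apply: le_trans (ltW lz) _; lra.
  - have f1K : f1 < K j2 by rewrite -{1}Kf1 plo_lt.
    have [r [r0 rK rj]] : exists r, [/\ 0 < r, r <= K j2 - b & r < K j2 - f1].
      by apply: small_pos; lra.
    exists r => //.
    move=> z /andP[dz zK]; have lz : (l^-1)%g z = z by apply/plo_fixV/lb; lra.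
    rewrite ploM lz -{1}(ploVK K z) mE plo_lt; apply: lR.
    rewrite plo_ltV zK andbT; apply: lt_le_trans jf1 _.
    by rewrite plo_Vle Kf1; lra.
by exists x, y, s', t', u1, um; split=> //; apply: gxy.
Qed.

Lemma both_ends_expander S s t k p : gap S s t -> generated S k ->
  k p = p -> s < p < t ->
  right_after k s \/ left_after k s -> right_before k t \/ left_before k t ->
  has_expander (generated S).
Proof.
move=> G gk kp pI A B; have gV := subgroupV (generated_subgroup S) gk.
case: A B => [A|A] [B|B].
- exact: same_direction_expander A B kp pI.
- exact: gap_expander gV (right_afterV A) (left_beforeV B).
- exact: gap_expander gk A B.
- exact: same_direction_expander gV (left_afterV A) (left_beforeV B) (plo_fixV kp) pI.
Qed.

Lemma fix_afterV x s : fix_after x s -> fix_after (x^-1)%g s.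
Proof. by case=> d d0 mv; exists d => // z /mv; apply: plo_fixV. Qed.
Lemma fix_beforeV x t : fix_before x t -> fix_before (x^-1)%g t.
Proof. by case=> d d0 mv; exists d => // z /mv; apply: plo_fixV. Qed.

Lemma split_ends_expander S s t g h : gap S s t -> generated S g -> generated S h ->
  right_after g s \/ left_after g s -> fix_before g t ->
  fix_after h s -> right_before h t \/ left_before h t ->
  has_expander (generated S).
Proof.
move=> G gg gh A fg fh B; have sG := generated_subgroup S.
have [_ fs _ _] := G.
have [g' [gg' A' fg']] : exists g', [/\ generated S g', left_after g' s & fix_before g' t].
  case: A => A; last by exists g.
  exists (g^-1)%g; split; [exact: (subgroupV sG)|exact: right_afterV|exact: fix_beforeV].
have [h' [gh' fh' B']] : exists h', [/\ generated S h', fix_after h' s & right_before h' t].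
  case: B => B; first by exists h.
  exists (h^-1)%g; split; [exact: (subgroupV sG)|exact: fix_afterV|exact: left_beforeV].
apply: (gap_expander G (subgroupM sG gg' gh')); last exact: right_beforeM.
exact: left_afterM (fixed_generated fs gg') A' fh'.
Qed.

Lemma gap_not_fix_after g h s t : gap [set g; h] s t ->
  fix_after g s -> fix_after h s -> False.
Proof.
move=> [st _ _ no] [d d0 fg] [d' d'0 fh].
have [r1 [r10 r1d r1d']] := small_pos d0 d'0.
have [r [r0 rr1 rst]] : exists r, [/\ 0 < r, r <= r1 & r < t - s].
  by apply: small_pos => //; lra.
by apply: (no (s + r)); [lra|apply/fixed2; split; [apply: fg|apply: fh]; lra].
Qed.

Lemma gap_not_fix_before g h s t : gap [set g; h] s t ->
  fix_before g t -> fix_before h t -> False.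
Proof.
move=> [st _ _ no] [d d0 fg] [d' d'0 fh].
have [r1 [r10 r1d r1d']] := small_pos d0 d'0.
have [r [r0 rr1 rst]] : exists r, [/\ 0 < r, r <= r1 & r < t - s].
  by apply: small_pos => //; lra.
by apply: (no (t - r)); [lra|apply/fixed2; split; [apply: fg|apply: fh]; lra].
Qed.

(** At each end of a gap of [g] and [h] one of the two is not the identity. Either one of
    them is nontrivial at both ends, or each of them is nontrivial at exactly one end
    and a product of the two or of their inverses repels. *)
Lemma pair_expander g h s t p q : gap [set g; h] s t ->
  g p = p -> s < p < t -> h q = q -> s < q < t ->
  has_expander (generated [set g; h]).
Proof.
move=> G gp pI hq qI; have [_ /fixed2[gs hs] /fixed2[gt ht] _] := G.
have gg : generated [set g; h] g by apply: sub_generated; left.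
have gh : generated [set g; h] h by apply: sub_generated; right.
have after k : k s = s -> (right_after k s \/ left_after k s) \/ fix_after k s.
  by move=> /after_cases[]; auto.
have before k : k t = t -> (right_before k t \/ left_before k t) \/ fix_before k t.
  by move=> /before_cases[]; auto.
case: (after _ gs) (before _ gt) => [gA|gA] [gB|gB].
- exact: both_ends_expander G gg gp pI gA gB.
- case: (before _ ht) => hB; last by case: (gap_not_fix_before G gB hB).
  case: (after _ hs) => hA; first exact: both_ends_expander G gh hq qI hA hB.
  exact: split_ends_expander G gg gh gA gB hA hB.
- case: (after _ hs) => hA; last by case: (gap_not_fix_after G gA hA).
  case: (before _ ht) => hB; first exact: both_ends_expander G gh hq qI hA hB.
  exact: split_ends_expander G gh gg hA hB gA gB.
- case: (after _ hs) => hA; last by case: (gap_not_fix_after G gA hA).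
  case: (before _ ht) => hB; last by case: (gap_not_fix_before G gB hB).
  exact: both_ends_expander G gh hq qI hA hB.
Qed.

(** An orbital of [g], in the sense of connected components, is a gap of [g]. *)
Lemma orbital_gap g a b : a < b -> orbital_of g (`]a, b[%classic) -> gap [set g] a b.
Proof.
move=> ab [x Sx E].
have SuppE z : Supp (generated [set g]) z <-> ~ fixed [set g] z.
  split=> [[_ [h gh /eqP hz]] fz|nz]; first exact/hz/(fixed_generated fz gh).
  have gz : g z <> z by move=> E0; apply/nz/fixed1.
  split; last by exists g; [apply: sub_generated|apply/eqP].
  by apply/andP; split; rewrite leNgt; apply/negP => lt; apply: gz;
    [apply: plo_le0|apply: plo_ge1]; apply: ltW.
have /SuppE/gap_exists[s [t [G /andP[sx xt]]]] := Sx.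
have [st fs ft no] := G.
have sub : `]s, t[%classic `<=` `]a, b[%classic.
  rewrite E; apply: (@connected_component_max _ (Supp (generated [set g])) _ x).
  - by rewrite /= in_itv /= sx.
  - by move=> z; rewrite /= in_itv /= => zI; apply/SuppE/no.
  - by apply/connected_intervalP; apply: interval_is_interval.
have out z : a < z < b -> ~ fixed [set g] z.
  move=> zI; apply/SuppE; apply: (@connected_component_sub _ _ x).
  by rewrite -E /= in_itv.
have /andP[ax xb] : a < x < b by have := sub x; rewrite /= !in_itv /= sx xt; apply.
have as_ : a = s.
  apply/eqP; rewrite eq_le !leNgt; apply/andP; split; apply/negP => lt.
    have := sub ((s + Num.min a x) / 2); rewrite (min_l (ltW ax)) /= !in_itv /=.
    by move=> h; have : a < (s + a) / 2 < b by [apply: h; lra]; lra.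
  by apply: (out s) => //; rewrite lt (lt_trans sx).
have bt : b = t.
  apply/eqP; rewrite eq_le !leNgt; apply/andP; split; apply/negP => lt.
    by apply: (out t) => //; rewrite lt (lt_trans ax).
  have := sub ((t + b) / 2); rewrite /= !in_itv /=.
  by move=> h; have : a < (t + b) / 2 < b by [apply: h; lra]; lra.
by rewrite as_ bt.
Qed.

Lemma chain_has_expander (H : set (PLo R)) : is_subgroup H ->
  admits_transition_chain2 H -> has_expander H.
Proof.
move=> sH [_ [al [ar [bl [br [g [h [-> sub [ab ba rr]]]]]]]]].
have [Hg /= og] : signed_orbital H (`]al, ar[%classic, g) by apply: sub; left.
have [Hh /= oh] : signed_orbital H (`]bl, br[%classic, h) by apply: sub; right.
have [_ _ /fixed1 gar nog] := orbital_gap (lt_trans ab ba) og.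
have [_ /fixed1 hbl _ noh] := orbital_gap (lt_trans ba rr) oh.
have : ~ fixed [set g; h] ar.
  by move=> /fixed2[_ /fixed1]; apply: noh; rewrite ba.
move=> /gap_exists[s [t [G /andP[sa at_]]]].
have sbl : s < bl.
  have [_ /fixed2[gs _] _ _] := G; rewrite (le_lt_trans _ ab) // leNgt.
  by apply/negP => lt; apply: (nog s); [rewrite lt|apply/fixed1].
have arI : s < ar < t by rewrite sa.
have blI : s < bl < t by rewrite sbl (lt_trans ba).
have [x [y [s' [t' [f1 [fm [gx gy E]]]]]]] := pair_expander G gar arI hbl blI.
have gH : generated [set g; h] `<=` H by apply: generated_sub => // _ [->|->].
by exists x, y, s', t', f1, fm; split=> //; apply: gH.
Qed.

End Repelling.

(** * Minimal displacing elements *)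

Section Minimal.
Variable R : realType.
Local Open Scope ring_scope.
Implicit Types (g h k x y v m : PLo R) (a b c d e s t z w : R) (n : nat) (S : set (PLo R)).

Lemma repelling_pull x s t f1 fm a c : repelling x s t f1 fm -> s < a -> c < f1 ->
  exists N, forall n, (N <= n)%N -> (x ^+ n)%g c < a.
Proof.
move=> [[sf1 _ _] [_ _ xf1 _] L _] sa cf1.
have [fa|af] := leP f1 a.
  exists 0%N => n _; apply: lt_le_trans fa.
  by rewrite -(plo_fixX n xf1) plo_lt.
have [||N NP] := @escape _ (x^-1)%g a c.
- by rewrite plo_Vlt L // sa.
- move=> z /andP[az zc]; rewrite plo_Vlt L // (lt_le_trans sa az).
  exact: le_lt_trans zc cf1.
by exists N => n /NP; rewrite expVgn plo_Vlt.
Qed.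

Lemma repelling_push x s t f1 fm a c : repelling x s t f1 fm -> a < t -> fm < c ->
  exists N, forall n, (N <= n)%N -> a < (x ^+ n)%g c.
Proof.
move=> [[_ _ fmt] [_ xt _ xfm] _ Rt] at_ fc.
have [af|fa] := leP a fm.
  exists 0%N => n _; apply: le_lt_trans af _.
  by rewrite -{1}(plo_fixX n xfm) plo_lt.
have [tc|ct] := leP t c.
  exists 0%N => n _; apply: lt_le_trans at_ _.
  by rewrite -{1}(plo_fixX n xt) plo_le.
apply: escape; first by rewrite Rt // fc.
by move=> z /andP[cz za]; rewrite Rt // (lt_le_trans fc cz) (le_lt_trans za).
Qed.

(** ** The elements with trivial germs at the common fixed points *)

(** The elements of the group generated by [x] and [y] that are the identity near each
    common fixed point. They include all commutators. *)
Definition core x y v :=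
  generated [set x; y] v /\ forall e, fixed [set x; y] e -> trivial_near v e.

Lemma coreM x y v m : core x y v -> core x y m -> core x y (v * m)%g.
Proof.
move=> [gv tv] [gm tm]; split; first exact: subgroupM (generated_subgroup _) gv gm.
by move=> e fe; apply: trivial_nearM; [apply: tv|apply: tm].
Qed.

Lemma core1 x y : core x y 1%g.
Proof.
split; first exact: subgroup1 (generated_subgroup _).
by move=> e _; exists 1.
Qed.

Lemma core_commutator x y g h : generated [set x; y] g -> generated [set x; y] h ->
  core x y [~ g, h]%g.
Proof.
have sG := generated_subgroup [set x; y].
move=> gg gh; split.
  by apply: (subgroupM sG); [apply: (subgroupV sG)|apply: (subgroupJ sG)].
by move=> e fe; apply: trivial_near_commutator; apply: fixed_generated fe _.
Qed.

Lemma trivial_near_left v s c : trivial_near v s -> s < c ->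
  exists k : R, [/\ s < k, k < c & forall z, s <= z <= k -> v z = z].
Proof.
move=> [d d0 tv] sc; have [r [r0 rd rc]] : exists r, [/\ 0 < r, r <= d & r < c - s].
  by apply: small_pos => //; lra.
by exists (s + r); split; [lra|lra|move=> z zI; apply: tv; lra].
Qed.

Lemma trivial_near_right v t c : trivial_near v t -> c < t ->
  exists k : R, [/\ c < k, k < t & forall z, k <= z <= t -> v z = z].
Proof.
move=> [d d0 tv] sc; have [r [r0 rd rc]] : exists r, [/\ 0 < r, r <= d & r < t - c].
  by apply: small_pos => //; lra.
by exists (t - r); split; [lra|lra|move=> z zI; apply: tv; lra].
Qed.

(** The commutator of a large power of [x] with the inverse of [g] moves [a0] beyond [b0]
    when [g] does, because [x] pushes [g a0] beyond [g b0]. *)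
Lemma core_displace x y s t f1 fm a b : gap [set x; y] s t ->
  repelling x s t f1 fm -> s < a -> b < t -> exists2 m, core x y m & b < m a.
Proof.
move=> G rep sa bt; have [[sf1 f1fm fmt] [xs xt xf1 xfm] L _] := rep.
have gx : generated [set x; y] x by apply: sub_generated; left.
have sG := generated_subgroup [set x; y]; have [_ _ ft _] := G.
pose a0 := Num.min a f1; pose b0 := Num.max b fm.
have sa0 : s < a0 by rewrite lt_min sa.
have b0t : b0 < t by rewrite gt_max bt.
have [g gg lt] := gap_displace G sa0 b0t.
have [N NP] : exists N, forall n, (N <= n)%N -> g b0 < (x ^+ n)%g (g a0).
  apply: (repelling_push rep).
    by rewrite -(fixed_generated ft gg) plo_lt.
  by apply: le_lt_trans lt; rewrite le_max lexx orbT.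
exists [~ x ^+ N, g^-1]%g.
  by apply: core_commutator; [apply: (subgroupX _ sG)|apply: (subgroupV sG)].
have aa0 : a0 <= a by rewrite ge_min lexx.
have bb0 : b <= b0 by rewrite le_max lexx.
apply: le_lt_trans bb0 _; apply: (@lt_le_trans _ _ ([~ x ^+ N, g^-1]%g a0));
  last by rewrite plo_le.
rewrite commgEl conjgE invgK !ploM plo_Vlt.
apply: lt_le_trans (NP _ (leqnn N)) _; rewrite !plo_le plo_Vle.
apply: (@powers_nonincreasing _ x 0 N) => //.
have [->|ne] := eqVneq a0 f1; first by rewrite xf1.
by apply/ltW/L; rewrite sa0 lt_neqAle ne ge_min lexx orbT.
Qed.

(** Suppose that, in each interval [(q.1, q.2)] of a finite family, elements of [C] move
    points arbitrarily far to the right. Then a single element of [C] moves each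
    interval [[lo q, hi q]] off itself. If [m] does so for the first interval, to the
    right, and [l] does so for large enough intervals in place of the other ones, then
    [l] or [m * l * m] does so for all. *)
Lemma simultaneous_displacement (C : set (PLo R)) (gs : seq (R * R)) :
  C 1%g -> (forall g h, C g -> C h -> C (g * h)%g) ->
  (forall q, q \in gs -> forall m, C m -> m q.1 = q.1 /\ m q.2 = q.2) ->
  (forall q, q \in gs -> forall a b, q.1 < a -> b < q.2 -> exists2 m, C m & b < m a) ->
  forall lo hi : R * R -> R, (forall q, q \in gs -> q.1 < lo q /\ hi q < q.2) ->
  exists2 m, C m & forall q, q \in gs -> hi q < m (lo q) \/ m (hi q) < lo q.
Proof.
move=> C1 CM; elim: gs => [|p gs IH] fixC disp lo hi lohi; first by exists 1%g.
have pin : p \in p :: gs by rewrite inE eqxx.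
have qin q : q \in gs -> q \in p :: gs by rewrite inE orbC => ->.
have [lop hip] := lohi p pin.
have [m Cm mp] := disp p pin _ _ lop hip.
pose lo' q := Num.min (lo q) (Num.min (m (lo q)) ((m^-1)%g (lo q))).
pose hi' q := Num.max (hi q) (Num.max (m (hi q)) ((m^-1)%g (hi q))).
have [||q qgs|l Cl lP] := IH _ _ lo' hi'.
- by move=> q /qin; apply: fixC.
- by move=> q /qin; apply: disp.
- have [l1 l2] := lohi q (qin q qgs); have [m1 m2] := fixC q (qin q qgs) m Cm.
  rewrite /lo' /hi' !lt_min !gt_max l1 l2 /=.
  by rewrite plo_Vlt plo_ltV m1 m2 l1 l2 -{1}m1 -{1}m2 !plo_lt l1 l2.
have lo1 q : lo' q <= lo q by rewrite ge_min lexx.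
have lo2 q : lo' q <= m (lo q) by rewrite !ge_min lexx !orbT.
have lo3 q : lo' q <= (m^-1)%g (lo q) by rewrite !ge_min lexx !orbT.
have hi1 q : hi q <= hi' q by rewrite le_max lexx.
have hi2 q : m (hi q) <= hi' q by rewrite !le_max lexx !orbT.
have hi3 q : (m^-1)%g (hi q) <= hi' q by rewrite !le_max lexx !orbT.
have [lp|nlp] := pselect (hi p < l (lo p) \/ l (hi p) < lo p).
  exists l => // q; rewrite inE => /orP[/eqP->//|/lP[lt|lt]]; [left|right].
    by apply: le_lt_trans (hi1 q) (lt_le_trans lt _); rewrite plo_le.
  by apply: lt_le_trans (lo1 q); apply: le_lt_trans lt; rewrite plo_le.
exists (m * l * m)%g; first exact: CM (CM _ _ Cm Cl) Cm.
move=> q; rewrite inE => /orP[/eqP->|/lP[lt|lt]].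
- left; rewrite !ploM (lt_trans mp) // plo_lt.
  have le : lo p <= l (hi p) by rewrite leNgt; apply/negP => lt; apply: nlp; right.
  by apply: le_lt_trans le _; rewrite plo_lt.
- left; rewrite !ploM -plo_ltV; apply: le_lt_trans (hi3 q) (lt_le_trans lt _).
  by rewrite plo_le.
- right; rewrite !ploM -plo_Vlt; apply: lt_le_trans (lo3 q).
  by apply: le_lt_trans lt; rewrite plo_le.
Qed.

Lemma count_lt (T : eqType) (p q : pred T) (l : seq T) (d : T) :
  (forall z : T, z \in l -> p z -> q z) -> d \in l -> q d -> ~~ p d ->
  (count p l < count q l)%N.
Proof.
move=> pq dl qd pd; elim: l dl pq => [//|c l IH] dl pq /=.
have pql (z : T) : z \in l -> p z -> q z by move=> zl; apply: pq; rewrite inE zl orbT.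
have le : (count p l <= count q l)%N.
  rewrite (@eq_in_count _ p (predI p q)); first by apply: sub_count => z /andP[].
  by move=> z /pql /=; case: (p z) => // ->.
move: dl; rewrite inE => /orP[/eqP E|dl]; first by rewrite -E (negbTE pd) qd ltnS.
by rewrite -addnS leq_add ?IH //; case: (p c) (pq c (mem_head _ _)) => // ->.
Qed.

(** Among the elements [y] of [H] that make an expander with [x], one is chosen that moves
    as few points as possible of a finite set [D] of fixed points of [x]. *)
Section Candidates.
Variables (H : set (PLo R)) (x : PLo R) (s t f1 fm : R) (D : seq R).
Hypotheses (sH : is_subgroup H) (Hx : H x) (rep : repelling x s t f1 fm).
Hypothesis xD : forall d, d \in D -> x d = d.

(** The elements of [H] that complete [x] into an expander. *)
Definition candidate y := [/\ H y, y s = s, y t = t & fm < y f1].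

(** The number of points of [D] that [y] moves. *)
Definition moved y := count (fun d => y d != d) D.

Variable y : PLo R.
Hypothesis cy : candidate y.
Hypothesis miny : forall y', candidate y' -> (moved y <= moved y')%N.

Let gx : generated [set x; y] x. Proof. by apply: sub_generated; left. Qed.
Let gy : generated [set x; y] y. Proof. by apply: sub_generated; right. Qed.
Let sG : is_subgroup (generated [set x; y]). Proof. exact: generated_subgroup. Qed.

Let fs : fixed [set x; y] s.
Proof. by case: rep => _ [xs _ _ _] _ _; case: cy => _ ys _ _; apply/fixed2. Qed.
Let ft : fixed [set x; y] t.
Proof. by case: rep => _ [_ xt _ _] _ _; case: cy => _ _ yt _; apply/fixed2. Qed.

Lemma candidate_core : exists2 v, core x y v & fm < v f1.
Proof.
have [[sf1 f1fm fmt] [xs xt xf1 xfm] L _] := rep; have [Hy ys yt yf] := cy.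
have [N NP] : exists N, forall n, (N <= n)%N -> y fm < (x ^+ n)%g (y f1).
  by apply: (repelling_push rep) => //; rewrite -yt plo_lt.
exists [~ x ^+ N, y^-1]%g.
  by apply: core_commutator; [apply: (subgroupX _ sG)|apply: (subgroupV sG)].
rewrite commgEl conjgE invgK !ploM plo_Vlt (plo_fixV (plo_fixX _ xf1)).
exact: NP.
Qed.

(** For large [M], the conjugate of [v] by the inverse of [x ^+ M * g * x ^- M] still moves
    [f1] beyond [fm], because [x ^- M] brings [g f1] and [g fm] back close to
    [[f1, fm]]. It fixes [d] and all points of [D] that [y] fixes, against the choice
    of [y]. *)
Lemma minimal_obstruction v d g : core x y v -> fm < v f1 -> d \in D -> y d <> d ->
  generated [set x; y] g ->
  (forall M, v ((x ^- M)%g (g d)) = (x ^- M)%g (g d)) -> False.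
Proof.
move=> [gv _] vf dD yd gg vfix.
have [[sf1 f1fm fmt] [xs xt xf1 xfm] L Rt] := rep.
have gH : generated [set x; y] `<=` H.
  by apply: generated_sub => // _ [->//|->]; case: cy.
have vt : v f1 < t by rewrite -(fixed_generated ft gv) plo_lt (le_lt_trans f1fm).
pose c2 := (fm + v f1) / 2; pose c1 := (v^-1)%g c2.
have fc2 : fm < c2 by rewrite /c2; lra.
have c1f : c1 < f1 by rewrite plo_ltV /c2; lra.
have sgf : s < g f1 by rewrite -(fixed_generated fs gg) plo_lt.
have gft : g fm < t by rewrite -(fixed_generated ft gg) plo_lt.
have [N1 N1P] := repelling_pull rep sgf c1f.
have [N2 N2P] := repelling_push rep gft fc2.
pose M := maxn N1 N2.
have lt1 : (x ^+ M)%g c1 < g f1 by apply: N1P; apply: leq_maxl.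
have lt2 : g fm < (x ^+ M)%g c2 by apply: N2P; apply: leq_maxr.
pose w := (x ^+ M * g * x ^- M)%g.
have gw : generated [set x; y] w.
  have gM : generated [set x; y] (x ^+ M)%g by apply: (subgroupX _ sG).
  apply: (subgroupM sG); last exact: (subgroupV sG).
  exact: (subgroupM sG).
pose y' := (w * v * w^-1)%g.
have gy' : generated [set x; y] y'.
  apply: (subgroupM sG); last exact: (subgroupV sG).
  exact: (subgroupM sG).
have cy' : candidate y'.
  split; [exact: gH|exact: fixed_generated fs gy'|exact: fixed_generated ft gy'|].
  rewrite -[y' f1]/((w^-1)%g (v (w f1))) plo_Vlt; apply: lt_trans (_ : c2 < _).
    by rewrite /w !ploM (plo_fixX _ xfm) plo_ltV.
  rewrite -(ploVK v c2) -/c1 plo_lt /w !ploM (plo_fixX _ xf1).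
  by rewrite plo_Vlt.
have := miny cy'; rewrite leqNgt => /negP; apply.
have wd : w d = (x ^- M)%g (g d) by rewrite !ploM (plo_fixX _ (xD dD)).
apply: (count_lt _ dD).
- move=> z zD; apply: contraNN => /eqP yz; apply/eqP.
  by apply: fixed_generated gy'; apply/fixed2; split=> //; apply: xD.
- exact/eqP.
- by rewrite negbK; apply/eqP; rewrite -[y' d]/((w^-1)%g (v (w d))) wd vfix -wd ploK.
Qed.

(** If [x] did not move the points before [t'] to the right, some [g] would move [d] so
    close to [t'] that [v] fixes all the points [(x ^- M) (g d)]; similarly at [s']. *)
Lemma minimal_ends d s' t' : d \in D -> y d <> d -> gap [set x; y] s' t' ->
  s' < d < t' -> left_after x s' /\ right_before x t'.
Proof.
move=> dD yd G /andP[sd dt]; have [v cv vf] := candidate_core.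
have [_ fs' ft' _] := G; have [xs' _] := (fixed2 x y s').1 fs'.
have [xt' _] := (fixed2 x y t').1 ft'.
split.
- have bad : (exists2 r : R, 0 < r & forall z, s' < z <= s' + r -> z <= x z) -> False.
    move=> [r r0 mv]; have [k [sk kr vk]] : exists k : R, [/\ s' < k, k < s' + r &
        forall z, s' <= z <= k -> v z = z].
      by apply: trivial_near_left; [apply: cv.2|rewrite ltrDl].
    have [g gg gk] := gap_displace G sk dt.
    have gd : (g^-1)%g d < k by rewrite plo_ltV.
    have sgd : s' < (g^-1)%g d by rewrite plo_Vlt (fixed_generated fs' gg).
    apply: (minimal_obstruction cv vf dD yd (subgroupV sG gg)) => M.
    apply: vk; rewrite plo_Vle plo_leV (plo_fixX _ xs') (ltW sgd) /=.
    apply: le_trans (ltW gd) _; apply: (@powers_nondecreasing _ x 0 M) => //.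
    by apply: mv; rewrite sk ltW.
  case: (after_cases xs') => // -[r r0 mv]; case: bad; exists r => // z /mv.
    exact: ltW.
  by move=> ->.
- have bad : (exists2 r : R, 0 < r & forall z, t' - r <= z < t' -> x z <= z) -> False.
    move=> [r r0 mv]; have [k [rk kt vk]] : exists k : R, [/\ t' - r < k, k < t' &
        forall z, k <= z <= t' -> v z = z].
      by apply: trivial_near_right; [apply: cv.2|rewrite ltrBlDr ltrDl].
    have [g gg gk] := gap_displace G sd kt.
    have gdt : g d < t' by rewrite -(fixed_generated ft' gg) plo_lt.
    apply: (minimal_obstruction cv vf dD yd gg) => M.
    apply: vk; rewrite plo_Vle plo_leV (plo_fixX _ xt') (ltW gdt) andbT.
    apply: le_trans (ltW gk); apply: (@powers_nonincreasing _ x 0 M) => //.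
    by apply: mv; rewrite kt ltW.
  case: (before_cases xt') => // -[r r0 mv]; case: bad; exists r => // z /mv.
    exact: ltW.
  by move=> ->.
Qed.

(** One element of the core moves off itself the hull [[u1, um]] of the fixed points of
    [x] in each gap of [x] and [y] that contains a point of [D]. *)
Lemma core_displaces_all : exists2 v, core x y v & forall d, d \in D -> y d <> d ->
  exists s' t' u1 um, [/\ gap [set x; y] s' t', s' < d < t',
    repelling x s' t' u1 um & um < v u1 \/ v um < u1].
Proof.
pose gp d : R * R := xget (0, 0) [set q | gap [set x; y] q.1 q.2 /\ q.1 < d < q.2].
pose hull (q : R * R) : R * R := xget (0, 0) [set u | repelling x q.1 q.2 u.1 u.2].
pose gs := [seq gp d | d <- D & y d != d].
have gpP d : d \in D -> y d <> d ->
    gap [set x; y] (gp d).1 (gp d).2 /\ (gp d).1 < d < (gp d).2.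
  move=> dD yd; have : ~ fixed [set x; y] d by move=> /fixed2[].
  move=> /gap_exists[s' [t' [G I]]].
  by apply: (@xgetPex _ (0, 0) [set q | gap [set x; y] q.1 q.2 /\ q.1 < d < q.2]);
    exists (s', t').
have hullP d : d \in D -> y d <> d ->
    repelling x (gp d).1 (gp d).2 (hull (gp d)).1 (hull (gp d)).2.
  move=> dD yd; have [G I] := gpP d dD yd.
  have [La Rb] := minimal_ends dD yd G I.
  have [lt /fixed2[xs' _] /fixed2[xt' _] _] := G.
  have [u1 [um rep']] := repelling_exists lt xs' xt' La Rb.
  by apply: (@xgetPex _ (0, 0) [set u | repelling x (gp d).1 (gp d).2 u.1 u.2]);
    exists (u1, um).
have gsP q : q \in gs -> exists d, [/\ d \in D, y d <> d & q = gp d].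
  by move=> /mapP[d]; rewrite mem_filter => /andP[/eqP yd dD] ->; exists d.
have [||q|q|q|v cv vP] := @simultaneous_displacement (core x y) gs _ _ _ _
    (fun q => (hull q).1) (fun q => (hull q).2).
- exact: core1.
- by move=> g h; apply: coreM.
- move=> /gsP[d [dD yd ->]] m [gm _]; have [[_ fs' ft' _] _] := gpP d dD yd.
  by rewrite (fixed_generated fs' gm) (fixed_generated ft' gm).
- move=> /gsP[d [dD yd ->]] a b; have [G I] := gpP d dD yd.
  exact: core_displace G (hullP d dD yd).
- move=> /gsP[d [dD yd ->]].
  by have [[-> ? ->] _ _ _] := hullP d dD yd.
exists v => // d dD yd; have [G I] := gpP d dD yd.
exists (gp d).1, (gp d).2, (hull (gp d)).1, (hull (gp d)).2; split=> //.
  exact: hullP.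
by apply: vP; apply: map_f; rewrite mem_filter dD andbT; apply/eqP.
Qed.

End Candidates.

Lemma minimal_candidate (H : set (PLo R)) s t f1 fm (D : seq R) y0 :
  candidate H s t f1 fm y0 -> exists2 y, candidate H s t f1 fm y &
    forall y', candidate H s t f1 fm y' -> (moved D y <= moved D y')%N.
Proof.
move=> c0; pose P n := `[< exists2 y, candidate H s t f1 fm y & moved D y = n >].
have exP : exists n, P n by exists (moved D y0); apply/asboolP; exists y0.
have [n /asboolP[y cy <-] miny] := ex_minnP exP.
by exists y => // y' cy'; apply: miny; apply/asboolP; exists y'.
Qed.

End Minimal.

(** * Layered pairs of piecewise-linear homeomorphisms *)

Section Regions.
Variable R : realType.
Local Open Scope ring_scope.
Implicit Types (g h k x y v m X : PLo R) (a b c d e s t z w : R) (i j n N : nat).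
Implicit Types (S : set (PLo R)) (Om : set R).

(** [g] maps [Om] onto itself. *)
Definition preserves Om g := forall w, Om (g w) <-> Om w.

(** [g] and [h] commute on the points of [Om]. *)
Definition commute_on Om g h := forall w, Om w -> g (h w) = h (g w).

Lemma preserves_generated Om S g : (forall h, S h -> preserves Om h) ->
  generated S g -> preserves Om g.
Proof.
move=> SOm; refine (@generated_ind _ _ (preserves Om) _ _ _ _ g) => //.
- by move=> a b aO bO w; rewrite ploM bO.
- by move=> a aO w; rewrite -aO ploVK.
Qed.

Lemma commute_on_generated Om S : (forall h, S h -> preserves Om h) ->
  (forall g h, S g -> S h -> commute_on Om g h) ->
  forall g h, generated S g -> generated S h -> commute_on Om g h.
Proof.
move=> SOm SC; have genl h : preserves Om h -> (forall g, S g -> commute_on Om g h) ->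
    forall g, generated S g -> commute_on Om g h.
  move=> hO Sh g gg.
  suff [] : preserves Om g /\ commute_on Om g h by [].
  refine (@generated_ind _ _ (fun g => preserves Om g /\ commute_on Om g h) _ _ _ _ g gg).
  - by split.
  - move=> a b [aO ac] [bO bc]; split=> w; first by rewrite ploM bO.
    by move=> Ow; rewrite !ploM ac // bc //; apply/aO.
  - move=> a [aO ac]; have aVO : preserves Om (a^-1)%g by move=> w; rewrite -aO ploVK.
    split=> // w Ow; rewrite -{1}(ploVK a w) -ac ?ploK //; exact/aVO.
  - by move=> a Sa; split; [apply: SOm|apply: Sh].
move=> g h gg gh; refine (genl h _ _ g gg); first exact: preserves_generated gh.
move=> a Sa w Ow; apply/esym; move: w Ow; refine (genl a _ _ h gh); first exact: SOm.
by move=> b Sb; apply: SC.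
Qed.

Lemma disjoint_commute_on Om g h : preserves Om g -> preserves Om h ->
  (forall w, Om w -> g w = w \/ h w = w) -> commute_on Om g h.
Proof.
move=> gO hO dis w Ow; have [gw|gw] := pselect (g w = w).
  rewrite gw; have [//|hw] := dis (h w) ((hO w).2 Ow).
  by have -> : h w = w by apply: (@plo_inj _ h).
have hw : h w = w by case: (dis w Ow).
rewrite hw; have [E|->//] := dis (g w) ((gO w).2 Ow).
by case: gw; apply: (@plo_inj _ g).
Qed.

(** On [Om], all conjugates of [v] by negative powers of [X] are supported in one
    interval, which [v] displaces. *)
Definition shields X v Om := exists c1 c2, [/\ c1 <= c2, c2 <= v c1 \/ v c2 <= c1 &
  forall i w, Om w -> ~ c1 < w < c2 -> (v ^ (X ^- i.+1))%g w = w].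

(** On [Om], the conjugates of [v] by [X ^- i], including [v] itself, commute. *)
Definition commuting_conjugates X v Om :=
  forall i j, commute_on Om (v ^ (X ^- i))%g (v ^ (X ^- j))%g.

(** An invariant region where being layered holds for one of two reasons. *)
Definition good_region X v Om := [/\ preserves Om X, preserves Om v &
  shields X v Om \/ commuting_conjugates X v Om].

Lemma preserves_conj Om X v n : preserves Om X -> preserves Om v ->
  preserves Om (v ^ (X ^- n))%g.
Proof.
move=> XO vO; have sG := generated_subgroup [set X; v].
have gX : generated [set X; v] (X ^- n)%g.
  apply: (subgroupV sG); apply: (subgroupX _ sG).
  by apply: sub_generated; left.
apply: (@preserves_generated _ [set X; v]); first by move=> _ [->|->].
by apply: (subgroupJ sG) => //; apply: sub_generated; right.
Qed.

(** If [v] moves an interval off itself, then so do its powers. *)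
Lemma displaced_power v c1 c2 n : c1 <= c2 -> c2 <= v c1 \/ v c2 <= c1 ->
  forall z, c1 < z < c2 -> ~ c1 < (v ^- n.+1)%g z < c2.
Proof.
move=> c12 vc z /andP[cz zc]; rewrite plo_Vlt plo_ltV => /andP[l1 l2].
case: vc => vc.
  have : (v ^+ 1)%g c1 <= (v ^+ n.+1)%g c1.
    by apply: powers_nondecreasing => //; apply: le_trans vc.
  move=> /(le_trans vc)/(lt_le_trans zc)/(lt_trans l1).
  by rewrite ltxx.
have : (v ^+ n.+1)%g c2 <= (v ^+ 1)%g c2.
  by apply: powers_nonincreasing => //; apply: le_trans vc _.
by move=> /le_trans/(_ vc)/(lt_le_trans l2)/(lt_trans cz); rewrite ltxx.
Qed.

Lemma good_regions_layered X v :
  (forall z, exists2 Om, Om z & good_region X v Om) -> layered X v.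
Proof.
move=> good u w p lu lw; apply: plo_eq => z.
have [Om Oz [XO vO reg]] := good z.
have lowO g : lower X v g -> preserves Om g.
  apply: preserves_generated => _ [i _ <-]; exact: preserves_conj.
suff : commute_on Om w (u ^ (v ^+ p.+1))%g by move=> /(_ z Oz).
case: reg => [[c1 [c2 [c12 vc fixc]]]|com].
  have low_fix g : lower X v g -> forall e, Om e -> ~ c1 < e < c2 -> g e = e.
    move=> lg e Oe ne; apply: (fixed_generated _ lg) => _ [i _ <-].
    exact: fixc.
  have vpO : preserves Om (v ^- p.+1)%g.
    have sG := generated_subgroup [set v].
    apply: (@preserves_generated _ [set v]); first by move=> _ ->.
    by apply: (subgroupV sG); apply: (subgroupX _ sG); apply: sub_generated.
  apply: disjoint_commute_on; first exact: lowO.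
    move=> e; rewrite conjgE !ploM.
    have vpO' q : Om ((v ^+ p.+1)%g q) <-> Om q by rewrite -vpO ploK.
    by rewrite vpO' (lowO u) // vpO.
  move=> e Oe; have [eI|ne] := pselect (c1 < e < c2); last by left; apply: low_fix.
  right; rewrite conjgE !ploM (low_fix u) ?ploVK //; first exact/vpO.
  exact: displaced_power eI.
pose S := [set (v ^ (X ^- i))%g | i in setT].
have lowS g : lower X v g -> generated S g.
  apply: generated_sub; first exact: generated_subgroup.
  by move=> _ [i _ <-]; apply: sub_generated; exists i.+1.
have Sv : generated S v.
  by apply: sub_generated; exists 0%N => //; rewrite expg0 invg1 conjg1.
have sS := generated_subgroup S.
apply: (@commute_on_generated _ S).
- by move=> _ [i _ <-]; apply: preserves_conj.
- by move=> _ _ [i _ <-] [j _ <-]; apply: com.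
- exact: lowS.
- by apply: (subgroupJ sS); [apply: lowS|apply: (subgroupX _ sS)].
Qed.

(** The conjugate of [v] moves the fixed point [f] of [X], so [f] lies in the supporting
    interval; but it fixes the preimage of [f] under [v], which does not. *)
Lemma shields_not_commute X v Om f : preserves Om X -> preserves Om v ->
  shields X v Om -> Om f -> X f = f -> v f <> f -> ~ commute v (v ^ X^-1)%g.
Proof.
move=> XO vO [c1 [c2 [c12 vc fixc]]] Of Xf vf com.
have yE z : (v ^ X^-1)%g z = (X^-1)%g (v (X z)) by rewrite conjgE invgK.
have yf : (v ^ X^-1)%g f <> f.
  by rewrite yE Xf => E; apply: vf; rewrite -{2}Xf -{2}E ploVK.
have fI : c1 < f < c2.
  apply: contrapT => ne; apply: yf; have := fixc 0%N f Of ne.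
  by rewrite expg1.
have nI := @displaced_power v c1 c2 0 c12 vc f fI; rewrite expg1 in nI.
have Ow : Om ((v^-1)%g f) by rewrite -vO ploVK.
have := fixc 0%N _ Ow nI; rewrite expg1 => yw.
apply: yf; have E : (v ^ X^-1)%g (v ((v^-1)%g f)) = v ((v ^ X^-1)%g ((v^-1)%g f)).
  by rewrite -[LHS]/((v * v ^ X^-1)%g ((v^-1)%g f)) com.
by rewrite yw ploVK in E.
Qed.

End Regions.

(** * The embedding of [B] *)

Section Embedding.
Variable R : realType.
Local Open Scope ring_scope.
Implicit Types (g h k x y v m X : PLo R) (a b c d e s t z w : R) (i j n N : nat) (S : set (PLo R)).

Lemma preserves_interval g s t : g s = s -> g t = t ->
  preserves [set w | s < w < t] g.
Proof. by move=> gs gt w; rewrite /= -{1}gs -{1}gt !plo_lt. Qed.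

Lemma conj_powerE X v n z : (v ^ (X ^- n))%g z = (X ^- n)%g (v ((X ^+ n)%g z)).
Proof. by rewrite conjgE invgK !ploM. Qed.

Lemma conj_power_fix X v n z : v ((X ^+ n)%g z) = (X ^+ n)%g z ->
  (v ^ (X ^- n))%g z = z.
Proof. by rewrite conj_powerE => ->; rewrite ploK. Qed.

Lemma fixed_point_good_region X v z : X z = z -> v z = z -> good_region X v [set z].
Proof.
move=> Xz vz; have fix_pres g : g z = z -> preserves [set z] g.
  by move=> gz w; split=> [/= E|-> //]; apply: (@plo_inj _ g); rewrite E.
have vXz n : (v ^ (X ^- n))%g z = z by apply: conj_power_fix; rewrite plo_fixX.
split; [exact: fix_pres|exact: fix_pres|right].
by move=> i j w ->; rewrite !vXz.
Qed.

(** A large power of [x^-1] carries the support of [v] in [(s, t)] into a small neighbourhood of the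
    hull [[u1, um]], small enough for [v] to move it off itself. *)
Lemma repelling_shields x s t u1 um v : repelling x s t u1 um ->
  v s = s -> v t = t -> trivial_near v s -> trivial_near v t ->
  um < v u1 \/ v um < u1 ->
  exists N0, forall N, (N0 <= N)%N -> shields (x ^+ N)%g v [set w | s < w < t].
Proof.
move=> rep vs vt tvs tvt disp; have [[su1 u1m umt] _ _ _] := rep.
have [k1 [sk1 k1u vk1]] := trivial_near_left tvs su1.
have [k2 [uk2 k2t vk2]] := trivial_near_right tvt umt.
have [c1 [c2 [c1u uc2 vc]]] : exists c1 c2, [/\ c1 < u1, um < c2 &
    c2 <= v c1 \/ v c2 <= c1].
  case: disp => lt.
    exists ((v^-1)%g ((um + v u1) / 2)), ((um + v u1) / 2).
    by rewrite plo_ltV ploVK; split; [lra|lra|left].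
  exists ((v um + u1) / 2), ((v^-1)%g ((v um + u1) / 2)).
  by rewrite plo_Vlt ploVK; split; [lra|lra|right].
have [N1 N1P] := repelling_pull rep sk1 c1u.
have [N2 N2P] := repelling_push rep k2t uc2.
exists (maxn N1 N2) => N NN; exists c1, c2; split=> //.
  by rewrite !ltW // (lt_trans c1u) // (le_lt_trans u1m).
move=> i w /andP[sw wt] /negP; rewrite negb_and -!leNgt => wI.
have big n : (n <= N)%N -> (n <= N * i.+1)%N.
  by move=> /leq_trans; apply; rewrite leq_pmulr.
have [_ [xs xt _ _] _ _] := rep.
apply: conj_power_fix; rewrite -expgnA.
case/orP: wI => [wc|cw].
  apply: vk1; rewrite -{1}(plo_fixX (N * i.+1) xs) plo_le (ltW sw) /=.
  apply: le_trans (ltW (N1P _ (big _ (leq_trans (leq_maxl _ _) NN)))).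
  by rewrite plo_le.
apply: vk2; rewrite -[X in _ && (_ <= X)](plo_fixX (N * i.+1) xt) plo_le (ltW wt) andbT.
apply: le_trans (ltW (N2P _ (big _ (leq_trans (leq_maxr _ _) NN)))) _.
by rewrite plo_le.
Qed.

(** Where [x] has no fixed point, a large power of [x] moves the support of [v] off
    itself, so that the conjugates of [v] have disjoint supports. *)
Lemma gap_commuting_conjugates x s t v : gap [set x] s t ->
  v s = s -> v t = t -> trivial_near v s -> trivial_near v t ->
  exists N0, forall N, (N0 <= N)%N ->
    commuting_conjugates (x ^+ N)%g v [set w | s < w < t].
Proof.
move=> G vs vt tvs tvt; have [st /fixed1 xs /fixed1 xt _] := G.
have [k1 [sk1 k1t vk1]] := trivial_near_left tvs st.
have [k2 [k12 k2t vk2]] := trivial_near_right tvt k1t.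
have vO n : preserves [set w | s < w < t] (v ^ (x ^- n))%g.
  by apply: preserves_conj; apply: preserves_interval.
suff [N0 [N0pos N0P]] : exists N0, (0 < N0)%N /\ forall n, (N0 <= n)%N ->
    forall w, k1 < w < k2 -> (x ^+ n)%g w <= k1 \/ k2 <= (x ^+ n)%g w.
  have dis i j w : s < w < t -> (i + N0 <= j)%N ->
      (v ^ (x ^- i))%g w = w \/ (v ^ (x ^- j))%g w = w.
    move=> /andP[sw wt] ij.
    have lo n : s <= (x ^+ n)%g w by rewrite -{1}(plo_fixX n xs) plo_le ltW.
    have hi n : (x ^+ n)%g w <= t by rewrite -[leRHS](plo_fixX n xt) plo_le ltW.
    have [wI|ne] := boolP (k1 < (x ^+ i)%g w < k2); last first.
      left; apply: conj_power_fix; move: ne; rewrite negb_and -!leNgt => /orP[le|le].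
        by apply: vk1; rewrite lo.
      by apply: vk2; rewrite hi andbT.
    right; apply: conj_power_fix.
    have E : (x ^+ j)%g w = (x ^+ (j - i))%g ((x ^+ i)%g w).
      by rewrite -ploM -expgnDr subnKC // (leq_trans _ ij) ?leq_addr.
    have le0 : (N0 <= j - i)%N by rewrite leq_subRL // (leq_trans _ ij) ?leq_addr.
    have [le|le] := N0P _ le0 _ wI.
      by apply: vk1; rewrite lo E.
    by apply: vk2; rewrite hi andbT E.
  exists N0 => N NN i j.
  have far i' j' : (i' < j')%N -> commute_on [set w | s < w < t]
      (v ^ ((x ^+ N) ^- i'))%g (v ^ ((x ^+ N) ^- j'))%g.
    move=> lt; rewrite -!expgnA; apply: disjoint_commute_on => // w wI.
    apply: dis => //; apply: leq_trans (leq_add (leqnn _) NN) _.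
    by rewrite addnC -mulnS leq_mul2l lt orbT.
  have [lt|lt|->] := ltngtP i j; [exact: far| |by []].
  by move=> w wI; rewrite (far j i).
have st1 : s < k1 < t by rewrite sk1.
have inI z : k1 <= z <= k2 -> s < z < t.
  by move=> /andP[kz zk]; rewrite (lt_le_trans sk1 kz) (le_lt_trans zk k2t).
case: (gap_direction G) => mv.
  have [N NP] : exists N, forall n, (N <= n)%N -> k2 < (x ^+ n)%g k1.
    by apply: escape; [apply: mv|move=> z /inI/mv].
  exists N.+1; split=> // n Nn w /andP[kw _]; right.
  by apply: le_trans (ltW (NP n (ltnW Nn))) _; rewrite plo_le ltW.
have [N NP] : exists N, forall n, (N <= n)%N -> k2 < ((x^-1)%g ^+ n)%g k1.
  by apply: escape; [rewrite plo_Vlt; apply: mv|move=> z /inI/mv; rewrite plo_Vlt].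
exists N.+1; split=> // n Nn w /andP[_ wk]; left.
rewrite -plo_Vle; apply: le_trans (ltW wk) (ltW _).
by have := NP n (ltnW Nn); rewrite expVgn.
Qed.

Lemma gap_right_unique S s t t' : gap S s t -> gap S s t' -> t = t'.
Proof.
move=> [st _ ft no] [st' _ ft' no'].
apply/eqP; rewrite eq_le !leNgt; apply/andP; split; apply/negP => lt.
  by apply: (no t') => //; rewrite st'.
by apply: (no' t) => //; rewrite st.
Qed.

Lemma frontier_in x (D : seq R) e :
  (forall e, x e = e -> e \notin D -> trivial_near x e) -> x e = e ->
  (forall d : R, 0 < d -> exists2 z, e - d <= z <= e + d & x z <> z) -> e \in D.
Proof.
move=> DP xe mv; apply: contraT => /(DP e xe)[d d0 tr].
by have [z zI []] := mv d d0; apply: tr.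
Qed.

Lemma gap_left_frontier x (D : seq R) s t :
  (forall e, x e = e -> e \notin D -> trivial_near x e) ->
  gap [set x] s t -> s \in D.
Proof.
move=> DP [st /fixed1 xs _ no]; apply: frontier_in DP xs _ => d d0.
have [r [r0 rd rt]] : exists r, [/\ 0 < r, r <= d & r < t - s].
  by apply: small_pos => //; lra.
by exists (s + r); [lra|move=> E; apply: (no (s + r)); [lra|apply/fixed1]].
Qed.

Lemma gap_right_frontier x (D : seq R) s t :
  (forall e, x e = e -> e \notin D -> trivial_near x e) ->
  gap [set x] s t -> t \in D.
Proof.
move=> DP [st _ /fixed1 xt no]; apply: frontier_in DP xt _ => d d0.
have [r [r0 rd rt]] : exists r, [/\ 0 < r, r <= d & r < t - s].
  by apply: small_pos => //; lra.
by exists (t - r); [lra|move=> E; apply: (no (t - r)); [lra|apply/fixed1]].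
Qed.

(** If [x] fixes one point of a gap of [x] and [y] and moves another one, then the
    gap contains a frontier point of the fixed set of [x]. *)
Lemma gap_no_frontier x y (D : seq R) s t :
  (forall e, x e = e -> e \notin D -> trivial_near x e) ->
  gap [set x; y] s t -> (forall d, d \in D -> ~ s < d < t) ->
  (forall z, s < z < t -> x z = z) \/ gap [set x] s t.
Proof.
move=> DP [st /fixed2[xs _] /fixed2[xt _] _] noD.
have [[w [wI xw]]|all] := pselect (exists w, s < w < t /\ x w <> w); last first.
  by left=> z zI; apply: contrapT => ne; apply: all; exists z.
right; have : ~ fixed [set x] w by move/fixed1.
move=> /gap_exists[s0 [t0 [G0 /andP[sw wt]]]]; have /andP[sw' wt'] := wI.
have [_ fs0 ft0 no0] := G0.
have -> : s = s0.
  apply/eqP; rewrite eq_le !leNgt; apply/andP; split; apply/negP => lt.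
    by apply: (no0 s); [rewrite lt (lt_trans sw')|apply/fixed1].
  by apply: (noD s0 (gap_left_frontier DP G0)); rewrite lt (lt_trans sw).
suff -> : t = t0 by [].
apply/eqP; rewrite eq_le !leNgt; apply/andP; split; apply/negP => lt.
  by apply: (noD t0 (gap_right_frontier DP G0)); rewrite lt (lt_trans sw').
by apply: (no0 t); [rewrite lt (lt_trans sw)|apply/fixed1].
Qed.

Lemma eventually_all (D : seq R) (P : R -> nat -> Prop) :
  (forall d, d \in D -> exists N0, forall N, (N0 <= N)%N -> P d N) ->
  exists N0, forall N, (N0 <= N)%N -> forall d, d \in D -> P d N.
Proof.
elim: D => [|c D IH] ev; first by exists 0%N.
have [|N1 N1P] := IH; first by move=> d dD; apply: ev; rewrite inE dD orbT.
have [N2 N2P] := ev c (mem_head _ _).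
exists (maxn N1 N2) => N; rewrite geq_max => /andP[le1 le2] d.
by rewrite inE => /orP[/eqP->|dD]; [apply: N2P|apply: N1P].
Qed.

(** With [y] minimal and [v] moving off itself the hull of the fixed points of [x] in each
    gap of [x] and [y] that meets [D], the real line splits into good regions for a
    large power of [x] and [v]: the common fixed points, the gaps that meet [D], the
    gaps where [x] has no fixed point, and the gaps where [x] is the identity. *)
Lemma expander_layered_pair (H : set (PLo R)) : is_subgroup H -> has_expander H ->
  exists X v, [/\ H X, H v, layered X v & ~ commute v (v ^ X^-1)%g].
Proof.
move=> sH [x [y0 [s [t [f1 [fm [Hx Hy0 [rep [y0s y0t y0f]]]]]]]]].
have [D [xD DP]] := frontier_fixed_finite x.
have [y cy miny] := minimal_candidate D (And4 Hy0 y0s y0t y0f).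
have [v [gv tv] vP] := core_displaces_all sH Hx rep xD cy miny.
have [Hy ys yt yf] := cy; have sG := generated_subgroup [set x; y].
have gx : generated [set x; y] x by apply: sub_generated; left.
have gH : generated [set x; y] `<=` H by apply: generated_sub => // _ [->|->].
have shD d : d \in D -> exists N0, forall N, (N0 <= N)%N ->
    y d <> d -> exists s' t', [/\ gap [set x; y] s' t', s' < d < t', v d <> d &
      shields (x ^+ N)%g v [set w | s' < w < t']].
  move=> dD; have [yd|yd] := pselect (y d = d); first by exists 0%N.
  have [s' [t' [u1 [um [G I rep' disp]]]]] := vP d dD yd; have [_ fs' ft' _] := G.
  have [N0 N0P] := repelling_shields rep' (fixed_generated fs' gv)
    (fixed_generated ft' gv) (tv _ fs') (tv _ ft') disp.
  exists N0 => N NN _; exists s', t'; split=> //; last exact: N0P.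
  have [_ _ L' R'] := rep'; move: I => /andP[sd dt].
  have ud : u1 <= d.
    by rewrite leNgt; apply/negP => lt; have := L' d; rewrite sd lt (xD _ dD) ltxx => /(_ isT).
  have du : d <= um.
    by rewrite leNgt; apply/negP => lt; have := R' d; rewrite dt lt (xD _ dD) ltxx => /(_ isT).
  move=> vd; case: disp => lt; have := lt; rewrite ltNge => /negP; apply.
    by apply: le_trans du; rewrite -vd plo_le.
  by apply: le_trans ud _; rewrite -vd plo_le.
have coD d : d \in D -> exists N0, forall N, (N0 <= N)%N ->
    forall t', gap [set x; y] d t' -> gap [set x] d t' ->
      commuting_conjugates (x ^+ N)%g v [set w | d < w < t'].
  (* There is at most one gap with left end [d]. *)
  move=> dD; have [[t' [G G0]]|none] :=
    pselect (exists t', gap [set x; y] d t' /\ gap [set x] d t'); last first.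
    by exists 0%N => N _ t' G G0; case: none; exists t'.
  have [_ fd ft' _] := G.
  have [N0 N0P] := gap_commuting_conjugates G0 (fixed_generated fd gv)
    (fixed_generated ft' gv) (tv _ fd) (tv _ ft').
  exists N0 => N NN t'' G'' _; by rewrite -(gap_right_unique G G''); apply: N0P.
have [N1 N1P] := eventually_all shD; have [N2 N2P] := eventually_all coD.
pose N := maxn N1 N2; pose X := (x ^+ N)%g.
have {}N1P := N1P N (leq_maxl _ _); have {}N2P := N2P N (leq_maxr _ _).
have gX : generated [set x; y] X by apply: (subgroupX _ sG).
have presI s' t' g : gap [set x; y] s' t' -> generated [set x; y] g ->
    preserves [set w | s' < w < t'] g.
  move=> [_ fs' ft' _] gg.
  by apply: preserves_interval; apply: fixed_generated gg.
have good z : exists2 Om, Om z & good_region X v Om.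
  have [fz|/gap_exists[s' [t' [G zI]]]] := pselect (fixed [set x; y] z).
    exists [set z] => //.
    by apply: fixed_point_good_region; apply: fixed_generated fz _.
  exists [set w | s' < w < t'] => //; split; [exact: presI|exact: presI|].
  have [[d [dD dI yd]]|nod] := pselect (exists d, [/\ d \in D, s' < d < t' & y d <> d]).
    left; have [s'' [t'' [G'' dI'' _ sh]]] := N1P d dD yd.
    by have [-> ->] := gap_unique G G'' dI dI''.
  right; have noD d : d \in D -> ~ s' < d < t'.
    move=> dD dI; apply: nod; exists d; split=> // yd.
    by case: G => _ _ _ /(_ d dI); apply; apply/fixed2; split=> //; apply: xD.
  have [fx|G0] := gap_no_frontier DP G noD; last first.
    by apply: N2P => //; apply: gap_left_frontier DP G0.
  (* Here [x] is the identity, so all conjugates of [v] agree with [v]. *)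
  have XE w n : s' < w < t' -> (v ^ (X ^- n))%g w = v w.
    move=> wI; have Xf u : s' < u < t' -> (X ^+ n)%g u = u.
      by move=> uI; apply: plo_fixX; apply: plo_fixX; apply: fx.
    rewrite conj_powerE (Xf w) //; apply/plo_fixV/Xf.
    exact: gap_interval G gv wI.
  move=> i j w wI; have vwI := gap_interval G gv wI.
  by rewrite (XE w i) // (XE w j) // !(XE (v w)).
have [[sf1 f1fm fmt] [xs xt xf1 xfm] L _] := rep.
have f1D : f1 \in D.
  apply: frontier_in DP xf1 _ => d d0.
  have [r [r0 rd rt]] : exists r, [/\ 0 < r, r <= d & r < f1 - s].
    by apply: small_pos => //; lra.
  exists (f1 - r); first by lra.
  by move=> E; have := L (f1 - r); rewrite E ltxx => /(_ _)/notF; apply; lra.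
have yf1 : y f1 <> f1 by move=> E; move: yf; rewrite E ltNge f1fm.
have [s' [t' [G I vf1 sh]]] := N1P f1 f1D yf1.
exists X, v; split; [exact: gH|exact: gH|exact: good_regions_layered|].
apply: (shields_not_commute _ _ sh I _ vf1); [exact: presI|exact: presI|].
exact: plo_fixX.
Qed.

End Embedding.

(** * The group [B] *)

Section GroupB.
Variable R : realType.
Local Open Scope ring_scope.
Implicit Types (z w : R) (n : nat).

Lemma beta0_le z : z <= 7/16 -> beta0 R z = z.
Proof.
by move=> h; rewrite /= /beta0_fun; case: (ltP z (7/16)) => h1 //;
  case: (ltP z (15/32)) => h2; lra.
Qed.

Lemma beta0_ge z : 9/16 <= z -> beta0 R z = z.
Proof.
move=> h; rewrite /= /beta0_fun; case: (ltP z (7/16)) => h1 //.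
case: (ltP z (15/32)) => h2; first by lra.
case: (ltP z (1/2)) => h3; first by lra.
by case: (ltP z (9/16)) => h4 //; lra.
Qed.

Lemma alpha_left z : z <= 1/2 -> alpha R z <= z.
Proof.
move=> h; rewrite /= /alpha_fun; case: (ltP z 0) => h0 //.
case: (ltP z (1/4)) => h1; first by lra.
case: (ltP z (7/16)) => h2; first by lra.
by case: (ltP z (9/16)) => h3; lra.
Qed.

Lemma alpha_right z : 1/2 <= z -> z <= alpha R z.
Proof.
move=> h; rewrite /= /alpha_fun; case: (ltP z 0) => h0; first by lra.
case: (ltP z (1/4)) => h1; first by lra.
case: (ltP z (7/16)) => h2; first by lra.
case: (ltP z (9/16)) => h3; first by lra.
case: (ltP z (3/4)) => h4; first by lra.
by case: (leP z 1) => h5 //; lra.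
Qed.

Lemma alpha_middle z : 7/16 <= z -> z < 9/16 -> alpha R z = 4 * z - 3/2.
Proof.
move=> h h'; rewrite /= /alpha_fun; case: (ltP z 0) => h0; first by lra.
case: (ltP z (1/4)) => h1; first by lra.
case: (ltP z (7/16)) => h2; first by lra.
by rewrite h'.
Qed.

Lemma beta0_middle z : 15/32 <= z -> z < 1/2 -> beta0 R z = z + 1/32.
Proof.
move=> h h'; rewrite /= /beta0_fun; case: (ltP z (7/16)) => h1; first by lra.
case: (ltP z (15/32)) => h2; first by lra.
by rewrite h'.
Qed.

(** The support of [beta0] is [(7/16, 9/16)]; its image under the inverse of [alpha]
    is [(31/64, 33/64)], which [beta0] displaces by exactly its length. *)
Lemma B_shields : shields (alpha R) (beta0 R) [set w | 0 < w < 1].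
Proof.
have aL : alpha R (31/64) = 7/16 by rewrite alpha_middle; lra.
have aR : alpha R (33/64) = 9/16 by rewrite alpha_middle; lra.
exists (31/64), (33/64); split; first by lra.
  by left; rewrite beta0_middle; lra.
move=> i w _ /negP; rewrite negb_and -!leNgt => wI; apply: conj_power_fix.
rewrite expgS ploM; case/orP: wI => [wc|cw].
  apply: beta0_le; have le : alpha R w <= 7/16 by rewrite -aL plo_le.
  apply: (le_trans _ le); apply: (@powers_nonincreasing _ _ 0 i) => //.
  by apply: alpha_left; apply: (le_trans le); lra.
apply: beta0_ge; have le : 9/16 <= alpha R w by rewrite -aR plo_le.
apply: (le_trans le); apply: (@powers_nondecreasing _ _ 0 i) => //.
by apply: alpha_right; apply: (le_trans _ le); lra.
Qed.

Let B_preserves (g : PLo R) : preserves [set w | 0 < w < 1] g.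
Proof. by apply: preserves_interval; [apply: plo_end0|apply: plo_end1]. Qed.

Lemma B_layered : layered (alpha R) (beta0 R).
Proof.
apply: good_regions_layered => z; have [zI|zI] := boolP (0 < z < 1).
  by exists [set w | 0 < w < 1] => //; split; [apply: B_preserves..|left; apply: B_shields].
have fz (g : PLo R) : g z = z.
  by move: zI; rewrite negb_and -!leNgt => /orP[z0|z1]; [apply: plo_le0|apply: plo_ge1].
by exists [set z] => //; apply: fixed_point_good_region.
Qed.

Lemma B_not_commute : ~ commute (beta0 R) (beta0 R ^ (alpha R)^-1)%g.
Proof.
apply: (shields_not_commute (@B_preserves _) (@B_preserves _) B_shields (f := 1/2)).
- by apply/andP; split; lra.
- by rewrite alpha_middle; lra.
- rewrite /= /beta0_fun; case: (ltP _ (7/16)) => h1; first by lra.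
  case: (ltP _ (15/32)) => h2; first by lra.
  case: (ltP _ (1/2)) => h3; first by lra.
  by case: (ltP _ (9/16)) => h4; lra.
Qed.

End GroupB.

Theorem theorem1p4 (R : realType) (H : set (PLo R)) (hH : is_subgroup H)
    (hchain : admits_transition_chain2 H) :
  embeds_in (B R) H.
Proof.
have [X [v [HX Hv lay nc]]] := expander_layered_pair hH (chain_has_expander hH hchain).
exists (generated [set X; v]); split; first exact: generated_subgroup.
  by apply: generated_sub => // _ [->|->].
exact: layered_isomorphic (@B_layered R) lay (@B_not_commute R) nc.
Qed.
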